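(* For every $n\ge2$, every integer $1\le k<n$, every unconditional convex body $L$ in $\mathbb{R}^n$, and every measure $\mu$ with even continuous non-negative density on $L$, $$\mu(L)\ \le\ e^k\,\frac{n}{n-k}\,c_{n,k}\,\max_{H\in Gr_{n-k}}\mu(L\cap H)\,|L|^{k/n}.$$
   Context: A convex body $L$ in $\mathbb{R}^n$ (compact convex set with non-empty interior containing the origin in its interior) is unconditional if $\|\sum_{i=1}^n\delta_ix_ie_i\|_L=\|\sum_{i=1}^n x_ie_i\|_L$ for all real $x_i$ and all signs $\delta_i=\pm1$, where $e_1,\dots,e_n$ is the standard basis and $\|x\|_L=\min\{a\ge0:x\in aL\}$. $Gr_{n-k}$ is the Grassmannian of $(n-k)$-dimensional linear subspaces of $\mathbb{R}^n$. If $\mu$ has density $g$, $\mu(L)=\int_L g$ and $\mu(L\cap H)=\int_{L\cap H}g$ with respect to $(n-k)$-dimensional Lebesgue measure on $H$. $|L|$ is volume, $B_2^m$ the Euclidean unit ball in $\mathbb{R}^m$, and $c_{n,k}=|B_2^n|^{\frac{n-k}{n}}/|B_2^{n-k}|$. *)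

(* Defs.v *)
From HB Require Import structures.
From mathcomp Require Import all_boot all_order all_algebra.
From mathcomp Require Import all_classical all_reals all_analysis.
Set Implicit Arguments. Unset Strict Implicit. Unset Printing Implicit Defensive.
Import Order.TTheory GRing.Theory Num.Theory.
Import numFieldNormedType.Exports.
Local Open Scope classical_set_scope.
Local Open Scope ring_scope.

(* Iterated Lebesgue integral over R^m (Tonelli: = m-dim Lebesgue integral
   for non-negative measurable integrands). *)
Fixpoint iint (R : realType) (m : nat) : ('rV[R]_m -> \bar R) -> \bar R :=
  match m with
  | 0 => fun f => f 0
  | m'.+1 => fun f =>
      (\int[@lebesgue_measure R]_x iint (fun y : 'rV[R]_m' => f (row_mx (x%:M) y)))%E
  end.

Definition vol (R : realType) (m : nat) (A : set 'rV[R]_m) : \bar R :=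
  iint (fun x => (\1_A x)%:E).

Definition eball (R : realType) (m : nat) : set 'rV[R]_m :=
  [set x | \sum_(i < m) x ord0 i ^+ 2 <= 1].

Definition convex_set_rV (R : realType) (n : nat) (L : set 'rV[R]_n) : Prop :=
  forall x y t, L x -> L y -> 0 <= t <= 1 -> L (t *: x + (1 - t) *: y).

Definition convex_body (R : realType) (n : nat) (L : set 'rV[R]_n) : Prop :=
  compact L /\ convex_set_rV L /\ interior L 0.

Definition gauge (R : realType) (n : nat) (L : set 'rV[R]_n) (x : 'rV[R]_n) : R :=
  inf [set a : R | 0 <= a /\ [set a *: y | y in L] x].

Definition unconditional (R : realType) (n : nat) (L : set 'rV[R]_n) : Prop :=
  forall (x : 'rV[R]_n) (d : 'I_n -> R), (forall i, d i = 1 \/ d i = -1) ->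
    gauge L (\row_i (d i * x ord0 i)) = gauge L x.

Definition mu_of (R : realType) (n : nat) (g : 'rV[R]_n -> R) (A : set 'rV[R]_n) : \bar R :=
  iint (fun x => (\1_A x * g x)%:E).

(* mu(L \cap H) w.r.t. (n-k)-dim Lebesgue measure on H, where H is the image of
   the linear isometry y |-> y *m Q, Q having orthonormal rows *)
Definition mu_section (R : realType) (n d : nat) (g : 'rV[R]_n -> R)
    (L : set 'rV[R]_n) (Q : 'M[R]_(d, n)) : \bar R :=
  iint (fun y : 'rV[R]_d => (\1_L (y *m Q) * g (y *m Q))%:E).

Definition max_section (R : realType) (n d : nat) (g : 'rV[R]_n -> R)
    (L : set 'rV[R]_n) : \bar R :=
  ereal_sup [set mu_section g L Q | Q in [set Q : 'M[R]_(d, n) | Q *m Q^T = 1%:M]].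

Definition c_const (R : realType) (n k : nat) : R :=
  (fine (vol (@eball R n))) `^ ((n - k)%:R / n%:R) / fine (vol (@eball R (n - k))).

(* Main.v *)
(* Let [d = n - k]. If [G] is a [d] by [n] matrix with independent rows, then [z |-> z *m G]
   pushes Lebesgue measure on R^d to a multiple of Lebesgue measure on a [d]-dimensional
   subspace; bounding all sections of [mu] by [M] therefore gives
   [int phi(zG) dz <= M/|B_2^d| * int 1_B(zG) dz], where [phi] is the density cut off to [L]
   and [B] is the unit ball, and for degenerate [G] the right-hand side is infinite.
   This is averaged over random [G] with independent columns, each a standard Gaussian vector
   scaled so that its one-dimensional marginals are Laplace: then [zG] has the law of
   [|z| y] with [y] of density [2^-n exp(-|y|_1)], and integrating over [z] turns both
   sides into integrals against [omega(|x|_1)], where [omega(s)] is proportional to [s^-k].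
   By Lozanovskii's argument, the point [a] of [L] maximizing the product of its coordinates
   satisfies [prod [-a_i, a_i] <= L] and [sum |x_i|/a_i <= n] on [L]. After the change of
   variables [x_i = a_i y_i], the weight is at least [omega(n)] on [L], while a layer-cake
   computation bounds its integral over the image of [B] by
   [omega(n) * n/d * m * (V/m)^(k/n)] with [m = |B| / prod a_i] and [V] the volume of
   [{|y|_1 <= n}], which is at most [(2e)^n]; and [2^n prod a_i <= |L|]. *)
Require Import Defs.
From HB Require Import structures.
From mathcomp Require Import all_boot all_order all_algebra.
From mathcomp Require Import all_classical all_reals all_analysis.
From mathcomp Require Import measurable_realfun.
From mathcomp Require Import ring lra.
Import Order.TTheory GRing.Theory Num.Theory.
Import numFieldNormedType.Exports.
Local Open Scope classical_set_scope.
Local Open Scope ring_scope.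
Set Implicit Arguments. Unset Strict Implicit. Unset Printing Implicit Defensive.


(** The Laplace law is dictated by Lozanovskii's inclusion. The rescaled [L] lies in [{|y|_1 <= n}],
    so a decreasing function of [|x|_1] is a weight with a sharp lower bound there, and the Laplace
    law is a product law whose density is such a function. It is also a mixture of centred
    Gaussians, which is what makes the law of [zG] depend on [z] through [|z|] alone. The degree of
    [omega] comes from scaling: [z] ranges over R^d while the density of [|z| y] carries [|z|^-n],
    and [d - n = -k]. The constant [e^k] comes from the l1-ball: [V <= (2e)^n] and
    [2^n prod a_i <= |L|] give [V/m <= e^n |L| / |B|], which is raised to the power [k/n]. The
    common factor [omega(n)] can be cancelled because it is positive and finite. *)

(** * Measurable structure on matrices *)

Section MatrixMeasurable.
Variables (R : realType) (m n : nat).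

(** The product sigma-algebra makes a matrix-valued map measurable as soon as its entries are; that
    it contains the open sets of row vectors is proved separately, for the body [L]. *)
Definition coord_cylinders : set (set 'M[R]_(m, n)) :=
  [set A | exists i j (B : set R), measurable B /\ A = [set M : 'M[R]_(m, n) | B (M i j)]].

Definition matrix_display : measure_display. Proof. exact: default_measure_display. Qed.

Let mx_set0 : <<s coord_cylinders >> set0.
Proof. exact: sigma_algebra0. Qed.

Let mx_setC A : <<s coord_cylinders >> A -> <<s coord_cylinders >> (~` A).
Proof. exact: sigma_algebraC. Qed.

Let mx_bigcup (F : _^nat) : (forall i, <<s coord_cylinders >> (F i)) ->
  <<s coord_cylinders >> (\bigcup_i (F i)).
Proof. exact: sigma_algebra_bigcup. Qed.

HB.instance Definition _ := @isMeasurable.Build matrix_display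
  'M[R]_(m, n) <<s coord_cylinders >> mx_set0 mx_setC mx_bigcup.

End MatrixMeasurable.

Section MatrixMeasurableFun.
Variables (R : realType) (m n : nat).

Lemma measurable_entry (i : 'I_m) (j : 'I_n) :
  measurable_fun [set: 'M[R]_(m, n)] (fun M => M i j : R).
Proof.
move=> _ B mB; rewrite setTI; apply: sub_sigma_algebra.
by exists i, j, B.
Qed.

Lemma measurable_fun_mx (disp : measure_display) (T : measurableType disp)
    (f : T -> 'M[R]_(m, n)) :
  (forall i j, measurable_fun setT (fun t => f t i j : R)) ->
  measurable_fun setT f.
Proof.
move=> mf _ A mA.
suff : <<s @coord_cylinders R m n >> `<=` [set B | measurable (f @^-1` B)].
  by move=> /(_ _ mA) /=; rewrite setTI.
apply: smallest_sub.
  split => /=.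
  - by rewrite preimage_set0.
  - move=> B mB /=; rewrite setTD -preimage_setC; exact: measurableC.
  - by move=> F mF /=; rewrite preimage_bigcup; apply: bigcupT_measurable.
move=> _ [i [j [B [mB ->]]]] /=.
by have := mf i j measurableT B mB; rewrite setTI.
Qed.

End MatrixMeasurableFun.

Lemma measurable_sum_ord (disp : measure_display) (T : measurableType disp)
    (R : realType) (n : nat) (f : 'I_n -> T -> R) :
  (forall i, measurable_fun setT (f i)) ->
  measurable_fun setT (fun t => \sum_(i < n) f i t).
Proof. by move=> mf; apply: measurable_sum. Qed.

Section MeasurableOps.
Context (R : realType) (disp : measure_display) (T : measurableType disp).

Lemma measurable_mx_entry (m n : nat) (f : T -> 'M[R]_(m, n)) i j :
  measurable_fun setT f -> measurable_fun setT (fun t => f t i j : R).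
Proof. by move=> mf; apply: (measurableT_comp (@measurable_entry R m n i j)). Qed.

Lemma measurable_mulmx (m n p : nat) (f : T -> 'M[R]_(m, n)) (g : T -> 'M[R]_(n, p)) :
  measurable_fun setT f -> measurable_fun setT g ->
  measurable_fun setT (fun t => f t *m g t).
Proof.
move=> mf mg; apply: measurable_fun_mx => i j.
under eq_fun do rewrite mxE.
by apply: measurable_sum_ord => k; apply: measurable_funM; exact: measurable_mx_entry.
Qed.

Lemma measurable_addmx (m n : nat) (f g : T -> 'M[R]_(m, n)) :
  measurable_fun setT f -> measurable_fun setT g ->
  measurable_fun setT (fun t => f t + g t).
Proof.
move=> mf mg; apply: measurable_fun_mx => i j.
under eq_fun do rewrite mxE.
by apply: measurable_funD; exact: measurable_mx_entry.
Qed.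

Lemma measurable_scalemx (m n : nat) (a : T -> R) (g : T -> 'M[R]_(m, n)) :
  measurable_fun setT a -> measurable_fun setT g ->
  measurable_fun setT (fun t => a t *: g t).
Proof.
move=> mf mg; apply: measurable_fun_mx => i j.
under eq_fun do rewrite mxE.
by apply: measurable_funM => //; exact: measurable_mx_entry.
Qed.

Lemma measurable_scalar_mx (a : T -> R) :
  measurable_fun setT a -> measurable_fun setT (fun t => (a t)%:M : 'M[R]_1).
Proof.
move=> ma; apply: measurable_fun_mx => i j.
rewrite !ord1.
by under eq_fun do rewrite mxE eqxx mulr1n.
Qed.

Lemma measurable_row_mx (m n1 n2 : nat) (f : T -> 'M[R]_(m, n1)) (g : T -> 'M[R]_(m, n2)) :
  measurable_fun setT f -> measurable_fun setT g ->
  measurable_fun setT (fun t => row_mx (f t) (g t)).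
Proof.
move=> mf mg; apply: measurable_fun_mx => i j.
under eq_fun do rewrite mxE.
by case: (fintype.split j) => k; exact: measurable_mx_entry.
Qed.

Lemma measurable_trmx (m n : nat) (f : T -> 'M[R]_(m, n)) :
  measurable_fun setT f -> measurable_fun setT (fun t => (f t)^T).
Proof.
move=> mf; apply: measurable_fun_mx => i j.
under eq_fun do rewrite mxE.
exact: measurable_mx_entry.
Qed.

Lemma measurable_matrix_of_fun (m n : nat) (F : T -> 'I_m -> 'I_n -> R) :
  (forall i j, measurable_fun setT (fun t => F t i j)) ->
  measurable_fun setT (fun t => \matrix_(i, j) F t i j).
Proof.
move=> mF; apply: measurable_fun_mx => i j.
rewrite (_ : (fun t => _) = fun t => F t i j)//.
by apply/funext => t; rewrite mxE.
Qed.

End MeasurableOps.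


(** * Sigma-finite products and images of measures *)

Section ProductSigmaFinite.
Context (R : realType) (d1 d2 : measure_display) (T1 : measurableType d1)
  (T2 : measurableType d2).
Variables (m1 : {sigma_finite_measure set T1 -> \bar R})
  (m2 : {sigma_finite_measure set T2 -> \bar R}).

Let prod : set (T1 * T2)%type -> \bar R := (m1 \x m2)%E.
HB.instance Definition _ := Measure.on prod.

Let prod_sigma_finiteT : sigma_finite setT prod.
Proof.
have /sigma_finiteP[F [FT ndF Fk]] := sigma_finiteT m1.
have /sigma_finiteP[G [GT ndG Gk]] := sigma_finiteT m2.
exists (fun k => F k `*` G k) => [|k].
  apply/esym; rewrite -subTset => -[x y] _.
  have : [set: T1] x by []. have : [set: T2] y by [].
  rewrite FT GT => -[j _ Gy] [i _ Fx]; exists (maxn i j) => //; split => /=.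
  - by move: x Fx; apply/subsetPset/ndF/leq_maxl.
  - by move: y Gy; apply/subsetPset/ndG/leq_maxr.
have [mF Foo] := Fk k; have [mG Goo] := Gk k; split; first exact: measurableX.
by rewrite /prod product_measure1E// lte_mul_pinfty// ge0_fin_numE.
Qed.

HB.instance Definition _ := @Measure_isSigmaFinite.Build _ _ _ prod prod_sigma_finiteT.

Definition prod_sigma_finite : {sigma_finite_measure set (T1 * T2)%type -> \bar R} := prod.

End ProductSigmaFinite.

Section PushforwardSigmaFinite.
Context (R : realType) (d1 d2 : measure_display) (T1 : measurableType d1)
  (T2 : measurableType d2).
Variables (mu : {sigma_finite_measure set T1 -> \bar R}) (phi : T1 -> T2) (psi : T2 -> T1).
Hypotheses (mphi : measurable_fun setT phi) (mpsi : measurable_fun setT psi)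
  (phiK : cancel phi psi).

Let nu : set T2 -> \bar R := pushforward mu phi.

Let nu0 : nu set0 = 0%E.
Proof. by rewrite /nu /pushforward preimage_set0 measure0. Qed.

Let nu_ge0 A : (0 <= nu A)%E.
Proof. exact: measure_ge0. Qed.

Let nu_sigma_additive : semi_sigma_additive nu.
Proof.
move=> F mF tF mUF; rewrite /nu /pushforward preimage_bigcup.
apply: measure_semi_sigma_additive.
- by move=> n; rewrite -[X in measurable X]setTI; exact: mphi.
- apply/trivIsetP => /= i j _ _ ij; rewrite -preimage_setI.
  by move/trivIsetP : tF => /(_ _ _ _ _ ij) ->//; rewrite preimage_set0.
- by rewrite -preimage_bigcup -[X in measurable X]setTI; exact: mphi.
Qed.

HB.instance Definition _ := isMeasure.Build _ _ _ nu nu0 nu_ge0 nu_sigma_additive.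

Let nu_sigma_finite : sigma_finite setT nu.
Proof.
have [F FT Fk] := sigma_finiteT mu.
(* The left inverse [psi] carries a cover by sets of finite measure to the target: pulling
   [psi^-1(F k)] back by [phi] gives [F k] again. *)
exists (fun k => psi @^-1` F k); first by rewrite -preimage_bigcup -FT preimage_setT.
move=> k; have [mF Foo] := Fk k; split.
  by rewrite -[X in measurable X]setTI; exact: mpsi.
rewrite /nu /pushforward (_ : phi @^-1` _ = F k)//.
by apply/seteqP; split => x /=; rewrite phiK.
Qed.

HB.instance Definition _ := @Measure_isSigmaFinite.Build _ _ _ nu nu_sigma_finite.

Lemma pushforward_sigma_finite :
  exists nu : {sigma_finite_measure set T2 -> \bar R},
    forall f, measurable_fun setT f -> (forall x, 0 <= f x)%E ->
      (\int[nu]_y f y = \int[mu]_x f (phi x))%E.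
Proof.
exists (nu : {sigma_finite_measure set T2 -> \bar R}) => f mf f0.
by rewrite ge0_integral_pushforward.
Qed.

End PushforwardSigmaFinite.

(** * Lebesgue measure on row vectors *)

Section LebesgueRowVectors.
Variable R : realType.
Local Notation leb := (@lebesgue_measure R).

Definition cons_row (m : nat) (x : R) (y : 'rV[R]_m) : 'rV[R]_m.+1 :=
  row_mx (x%:M : 'M[R]_1) y.

Lemma cons_row0 (m : nat) (x : R) (y : 'rV[R]_m) : cons_row x y ord0 ord0 = x.
Proof.
rewrite /cons_row (_ : ord0 = lshift m (ord0 : 'I_1)); last exact/val_inj.
by rewrite (@row_mxEl R 1 1 m) mxE eqxx.
Qed.

Lemma cons_rowS (m : nat) (x : R) (y : 'rV[R]_m) (i : 'I_m) :
  cons_row x y ord0 (lift ord0 i) = y ord0 i.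
Proof.
rewrite /cons_row (_ : lift ord0 i = rshift 1 i); last exact/val_inj.
by rewrite (@row_mxEr R 1 1 m).
Qed.

Lemma row_cons (m : nat) (F : 'I_m.+1 -> R) :
  \row_i F i = cons_row (F ord0) (\row_i F (lift ord0 i)).
Proof.
apply/rowP => i; rewrite mxE.
by case: (unliftP ord0 i) => [j|] ->; rewrite ?cons_row0// cons_rowS mxE.
Qed.

Lemma measurable_cons_row (m : nat) :
  measurable_fun setT (fun p : measurableTypeR R * 'rV[R]_m =>
    cons_row p.1 p.2).
Proof.
rewrite /cons_row; apply: (@measurable_row_mx R _ _ 1 1 m) => //.
exact: measurable_scalar_mx.
Qed.

Lemma measurable_cons_row_comp (disp : measure_display) (T : measurableType disp)
    (m : nat) (a : T -> R) (g : T -> 'rV[R]_m) :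
  measurable_fun setT a -> measurable_fun setT g ->
  measurable_fun setT (fun t => cons_row (a t) (g t)).
Proof.
move=> ma mg; rewrite /cons_row; apply: (@measurable_row_mx R _ _ 1 1 m) => //.
exact: measurable_scalar_mx.
Qed.

(** [iint] is only a functional, whereas Tonelli's theorem needs a sigma-finite measure. One is
    built coordinate by coordinate, as the image under [cons_row] of a product measure, starting
    from the Dirac mass in dimension 0. *)
Lemma lebesgue_rV_exists (m : nat) :
  exists mu : {sigma_finite_measure set 'rV[R]_m -> \bar R},
    forall f, measurable_fun setT f -> (forall x, 0 <= f x)%E ->
      (\int[mu]_x f x = iint f)%E.
Proof.
elim: m => [|m [mu muE]].
  exists (\d_(0 : 'rV[R]_0)) => f mf f0.
  by rewrite integral_dirac// diracT mul1e.
pose psi (v : 'rV[R]_(m.+1)) : measurableTypeR R * 'rV[R]_m :=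
  (v ord0 ord0, @rsubmx R 1 1 m v).
have mpsi : measurable_fun setT psi.
  apply/measurable_fun_pairP; split => /=; first exact: measurable_entry.
  apply: measurable_fun_mx => i j /=.
  by under eq_fun do rewrite mxE; exact: measurable_entry.
have psiK : cancel (fun p : measurableTypeR R * 'rV[R]_m =>
    cons_row p.1 p.2) psi.
  by case=> x y; rewrite /psi /= row_mxKr cons_row0.
have [nu nuE] := pushforward_sigma_finite (prod_sigma_finite leb mu) (@measurable_cons_row m) mpsi psiK.
exists nu => f mf f0.
rewrite nuE// (@fubini_tonelli1 _ _ _ _ _ leb mu)//=.
- rewrite /fubini_F; apply: eq_integral => x _; apply: muE => //.
  apply: (measurableT_comp mf).
  exact: (measurableT_comp (@measurable_cons_row m) (@measurable_pair1 _ _ _ _ x)).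
- exact: (measurableT_comp mf (@measurable_cons_row m)).
Qed.

Definition lebesgue_rV (m : nat) : {sigma_finite_measure set 'rV[R]_m -> \bar R} :=
  sval (cid (lebesgue_rV_exists m)).

Lemma iintE (m : nat) (f : 'rV[R]_m -> \bar R) :
  measurable_fun setT f -> (forall x, 0 <= f x)%E ->
  (iint f = \int[lebesgue_rV m]_x f x)%E.
Proof.
by move=> mf f0; rewrite /lebesgue_rV; case: cid => mu /= muE; rewrite muE.
Qed.

Lemma integral_lebesgue_rV0 (f : 'rV[R]_0 -> \bar R) : measurable_fun setT f ->
  (forall x, 0 <= f x)%E -> (\int[lebesgue_rV 0]_x f x = f 0%R)%E.
Proof. by move=> mf f0; rewrite -iintE. Qed.

Lemma integral_lebesgue_rVS (m : nat) (f : 'rV[R]_(m.+1) -> \bar R) :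
  measurable_fun setT f -> (forall x, 0 <= f x)%E ->
  (\int[lebesgue_rV m.+1]_x f x =
   \int[leb]_x \int[lebesgue_rV m]_y f (cons_row x y))%E.
Proof.
move=> mf f0; rewrite -iintE//=; apply: eq_integral => x _; apply: iintE => //.
apply: (measurableT_comp mf).
exact: (measurableT_comp (@measurable_cons_row m) (@measurable_pair1 _ _ _ _ x)).
Qed.

End LebesgueRowVectors.


(** * Tonelli's theorem for curried integrands; tactics for measurability and sign conditions *)

Section Tonelli.
Context (R : realType) (d1 d2 : measure_display) (T1 : measurableType d1)
  (T2 : measurableType d2).
Variables (m1 : {sigma_finite_measure set T1 -> \bar R})
  (m2 : {sigma_finite_measure set T2 -> \bar R}) (f : T1 -> T2 -> \bar R).
Hypotheses (mf : measurable_fun setT (fun p : T1 * T2 => f p.1 p.2))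
  (f0 : forall x y, (0 <= f x y)%E).

Lemma tonelli_curried :
  (\int[m1]_x \int[m2]_y f x y = \int[m2]_y \int[m1]_x f x y)%E.
Proof. by apply: (fubini_tonelli (fun p => f p.1 p.2)) => // -[]. Qed.

Lemma integral_prod_curried :
  (\int[prod_sigma_finite m1 m2]_p f p.1 p.2 = \int[m1]_x \int[m2]_y f x y)%E.
Proof. by apply: (fubini_tonelli1 (fun p => f p.1 p.2)) => // -[]. Qed.

Lemma measurable_integralr : measurable_fun setT (fun x => \int[m2]_y f x y)%E.
Proof. by apply: (measurable_fun_fubini_tonelli_F (fun p => f p.1 p.2)) => // -[]. Qed.

End Tonelli.

Lemma measurable_sqrt (R : realType) : measurable_fun setT (@Num.sqrt R).
Proof. by apply: continuous_measurable_fun; exact: sqrt_continuous. Qed.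

(** Inversion is continuous off 0, and the single point 0 is treated apart. *)
Lemma measurable_invr (R : realType) : measurable_fun setT (@GRing.inv R).
Proof.
rewrite (_ : setT = ~` [set 0] `|` [set 0 : R]); last by rewrite setUC setUv.
apply/measurable_funU => //; first exact: measurableC.
split; last exact: measurable_fun_set1.
apply: open_continuous_measurable_fun.
  by rewrite openC; exact: closed_eq.
by move=> x; rewrite inE /= => /eqP x0; exact: inv_continuous.
Qed.

Lemma measurable_ler_indic (R : realType) (disp : measure_display)
    (T : measurableType disp) (f g : T -> R) :
  measurable_fun setT f -> measurable_fun setT g ->
  measurable_fun setT (fun t => (f t <= g t)%R%:R : R).
Proof.
move=> mf mg.
have mA : measurable [set t | f t <= g t].
  by have := measurable_fun_ler mf mg; move=> /(_ measurableT [set true] _); rewrite setTI; apply.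
rewrite (_ : (fun t => _) = \1_[set t | f t <= g t]); first exact: measurable_indic.
apply/funext => t; rewrite indicE; case: (boolP (f t <= g t)%R) => fg.
  by rewrite mem_set.
by rewrite memNset//; exact/negP.
Qed.

Ltac mstep := match goal with
| |- measurable_fun _ (fun _ => ?c) => exact: measurable_cst
| |- measurable_fun _ (fun x => x) => exact: measurable_id
| |- measurable_fun _ fst => exact: measurable_fst
| |- measurable_fun _ snd => exact: measurable_snd
| |- measurable_fun _ (fun x => fst x) => exact: measurable_fst
| |- measurable_fun _ (fun x => snd x) => exact: measurable_snd
| H : measurable_fun _ ?f |- measurable_fun _ ?f => exact: H
| H : measurable_fun _ ?f |- measurable_fun _ (fun x => ?f x) => exact: H
| |- measurable_fun _ (fun _ => EFin _) => apply/measurable_EFinP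
| |- measurable_fun _ (fun _ => (_ * _)%E) => apply: emeasurable_funM
| |- measurable_fun _ (fun _ => (_ * _)%R) => apply: measurable_funM
| |- measurable_fun _ (fun _ => GRing.natmul _ (nat_of_bool (Order.le _ _))) =>
    apply: measurable_ler_indic
| |- measurable_fun _ (fun _ => (- _)%R) => apply: measurable_funN
| |- measurable_fun _ (fun _ => (_ ^+ _)%R) => apply: measurable_funX
| |- measurable_fun _ (fun _ => (_ ^-1)%R) => apply: (measurableT_comp (@measurable_invr _))
| |- measurable_fun _ (fun _ => expR _) => apply: (measurableT_comp (@measurable_expR _))
| |- measurable_fun _ (fun _ => Num.sqrt _) => apply: (measurableT_comp (@measurable_sqrt _))
| |- measurable_fun _ (fun _ => `| _ |) => apply: (measurableT_comp (@normr_measurable _ setT))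
| |- measurable_fun _ (fun _ => bigop.body _ _ _) =>
    first [apply: measurable_sum_ord => ? | apply: measurable_prod => ? _]
| |- measurable_fun _ (fun _ => _ *m _) => apply: measurable_mulmx
| |- measurable_fun _ (fun _ => cons_row _ _) => apply: measurable_cons_row_comp
| |- measurable_fun _ (fun _ => row_mx _ _) => apply: measurable_row_mx
| |- measurable_fun _ (fun _ => trmx _) => apply: measurable_trmx
| |- measurable_fun _ (fun _ => _%:M) => apply: measurable_scalar_mx
| |- measurable_fun _ (fun _ => _ *: _) => apply: measurable_scalemx
| |- measurable_fun _ (fun _ => (_ + _)%R) => first [apply: measurable_funD | apply: measurable_addmx]
| |- measurable_fun _ (fun _ => fun_of_matrix _ _ _) => apply: measurable_mx_entry
| |- measurable_fun _ (fun _ => @matrix_of_fun _ _ _ _ _) =>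
    apply: measurable_matrix_of_fun => ? ?
| |- measurable_fun _ (fun x => fst (@?g x)) => apply: (measurableT_comp measurable_fst)
| |- measurable_fun _ (fun x => snd (@?g x)) => apply: (measurableT_comp measurable_snd)
| H : measurable_fun _ ?f |- measurable_fun _ (fun x => ?f (@?g x)) =>
    apply: (measurableT_comp H)
| H : forall i, measurable_fun _ (?f i) |- measurable_fun _ (fun x => ?f ?i (@?g x)) =>
    apply: (measurableT_comp (H i))
| |- measurable_fun _ (fun _ => (_, _)) => apply/measurable_fun_pairP; split => /=
| |- measurable_fun _ (fun _ => (integral _ _ _)) => apply: measurable_integralr => /=
| |- measurable_fun ?D ?f =>
    lazymatch f with (fun _ => _) => fail | _ => change (measurable_fun D (fun x => f x)) end
end.
Ltac mfun := repeat mstep.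

Ltac nonneg := intros; repeat match goal with
| |- is_true (Order.le _ (mule _ _)) => apply: mule_ge0
| |- is_true (Order.le _ (EFin _)) => rewrite lee_fin
| |- is_true (Order.le _ (integral _ _ _)) => apply: integral_ge0 => ? _
| |- is_true (Order.le _ (GRing.mul _ _)) => apply: mulr_ge0
| |- is_true (Order.le _ (GRing.inv _)) => rewrite invr_ge0
| |- is_true (Order.le _ (GRing.exp _ _)) => apply: exprn_ge0
| |- is_true (Order.le _ (GRing.natmul _ _)) => exact: ler0n
| |- is_true (Order.le _ (expR _)) => exact: expR_ge0
| |- is_true (Order.le _ (Num.sqrt _)) => exact: sqrtr_ge0
| |- is_true (Order.le _ (bigop.body _ _ _)) => first [apply: prodr_ge0 => ? _ | apply: sumr_ge0 => ? _]
| H : is_true (Order.lt _ ?x) |- is_true (Order.le _ ?x) => exact: (ltW H)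
| H : forall x, is_true (Order.le _ (?f x)) |- is_true (Order.le _ (?f _)) => exact: H
| _ => done
end.
Ltac iside := solve [by mfun | by nonneg | by mfun; nonneg].

(** * Coordinatewise changes of variables *)

Section LebesgueAffine.
Variable R : realType.
Local Notation leb := (@lebesgue_measure R).
Local Notation lam := (@lebesgue_rV R).

Lemma integral_lebesgue_affine (a b : R) (f : R -> \bar R) : 0 < a ->
  measurable_fun setT f -> (forall x, 0 <= f x)%E ->
  (\int[leb]_x f (a * x + b)%R = \int[leb]_x ((a^-1)%:E * f x))%E.
Proof.
move=> a0 mf f0.
pose phi (x : measurableTypeR R) : measurableTypeR R := a * x + b.
pose psi (x : measurableTypeR R) : measurableTypeR R := a^-1 * (x - b).
have mphi : measurable_fun setT phi by rewrite /phi; mfun.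
have mpsi : measurable_fun setT psi by rewrite /psi; mfun.
have phiK : cancel phi psi by move=> x; rewrite /phi /psi addrK mulKf ?gt_eqF.
have [nu nuE] := pushforward_sigma_finite leb mphi mpsi phiK.
rewrite -[LHS]nuE// ge0_integralZl_EFin ?invr_ge0 ?ltW//.
have ca : 0 <= a by exact: ltW.
(* Scaled by [a], the image measure gives each interval []x, y]] its length, which characterizes
   Lebesgue measure. *)
have lebE A : measurable A -> leb A = mscale (NngNum ca) nu A.
  move=> mA; apply: lebesgue_measure_unique mA => _ [[x y]] _ <-.
  pose x' := a^-1 * (x - b); pose y' := a^-1 * (y - b).
  transitivity (a%:E * leb `]x', y']%classic)%E.
    rewrite !lebesgue_measure_itv/= !lte_fin /x' /y' ltr_pM2l ?invr_gt0// ltrD2r.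
    case: ifPn => // _; last by rewrite mule0.
    rewrite -!EFinB -EFinM -mulrBr mulVKf ?gt_eqF//.
    by congr EFin; ring.
  congr (_ * _)%E.
  transitivity (\int[nu]_t (\1_`]x, y] t)%:E)%E; last by rewrite integral_indic// setIT.
  rewrite nuE//; last by apply/measurable_EFinP; exact: measurable_indic.
  rewrite (_ : (fun t => (\1_`]x, y] (phi t))%:E) =
    (fun t => (\1_`]x', y'] t)%:E)).
    by rewrite integral_indic// setIT.
  apply/funext => t; rewrite !indicE; congr (_%:R%:E).
  rewrite !mem_setE !in_itv/= /phi /x' /y'.
  by rewrite ltr_pdivrMl// ler_pdivlMl// ltrBlDr lerBrDr.
rewrite (eq_measure_integral (mscale (NngNum ca) nu) (fun A mA _ => lebE A mA)).
by rewrite ge0_integral_mscale//= muleA -EFinM mulVf ?gt_eqF// mul1e.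
Qed.

(** Each [phi i] sends Lebesgue measure to the measure of density [rho i]; the densities multiply by
    induction on the coordinates, so no Jacobian determinant enters. *)
Lemma integral_coordwise (n : nat) (phi rho : 'I_n -> R -> R) :
  (forall i, measurable_fun setT (phi i)) -> (forall i, measurable_fun setT (rho i)) ->
  (forall i x, 0 <= rho i x) ->
  (forall i f, measurable_fun setT f -> (forall x, 0 <= f x)%E ->
     (\int[leb]_x f (phi i x) = \int[leb]_x ((rho i x)%:E * f x))%E) ->
  forall f, measurable_fun setT f -> (forall x, 0 <= f x)%E ->
  (\int[lam n]_x f (\row_i phi i (x ord0 i)) =
   \int[lam n]_x ((\prod_i rho i (x ord0 i))%R%:E * f x))%E.
Proof.
elim: n phi rho => [|n IH] phi rho mphi mrho rho0 H f mf f0.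
  rewrite !integral_lebesgue_rV0//; last 3 first.
  - by mfun.
  - by move=> x; rewrite big_ord0 mul1e.
  - by mfun.
  by rewrite big_ord0 mul1e; congr f; apply/rowP => -[].
have p0 (x : 'rV[R]_n) : (0 <= (\prod_i rho (lift ord0 i) (x ord0 i))%:E)%E.
  by rewrite lee_fin; apply: prodr_ge0.
rewrite !integral_lebesgue_rVS//; last 3 first.
- by mfun.
- by move=> x; apply: mule_ge0 => //; rewrite lee_fin; apply: prodr_ge0.
- by mfun.
pose F s := (\int[lam n]_y ((\prod_i rho (lift ord0 i) (y ord0 i))%R%:E * f (cons_row s y)))%E.
have mF : measurable_fun setT F.
  rewrite /F; mfun; last by move=> x y; apply: mule_ge0 => //; exact: p0.
have F0 x : (0 <= F x)%E.
  by apply: integral_ge0 => y _; apply: mule_ge0 => //; exact: p0.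
transitivity (\int[leb]_s F (phi ord0 s))%E.
  apply: eq_integral => s _; rewrite /F.
  have mg : measurable_fun setT (fun y => f (cons_row (phi ord0 s) y)) by mfun.
  rewrite -(IH (fun i => phi (lift ord0 i)) (fun i => rho (lift ord0 i)))//; last by move=> i; exact: H.
  apply: eq_integral => y _; congr f; rewrite row_cons cons_row0; congr cons_row.
  by apply/rowP => i; rewrite [LHS]mxE [RHS]mxE cons_rowS.
rewrite (H ord0 F mF F0); apply: eq_integral => s _.
rewrite /F -ge0_integralZl ?lee_fin//; last 2 first.
- by mfun.
- by move=> y _; apply: mule_ge0 => //; exact: p0.
apply: eq_integral => y _; rewrite big_ord_recl cons_row0 EFinM -muleA.
by under [in RHS]eq_bigr do rewrite cons_rowS.
Qed.

Lemma integral_prod_coord (n : nat) (rho : 'I_n -> R -> R) :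
  (forall i, measurable_fun setT (rho i)) -> (forall i x, 0 <= rho i x) ->
  (\int[lam n]_x (\prod_i rho i (x ord0 i))%:E =
   \prod_(i < n) \int[leb]_x (rho i x)%:E)%E.
Proof.
elim: n rho => [|n IH] rho mrho rho0.
  rewrite integral_lebesgue_rV0; first by rewrite !big_ord0.
  - by mfun.
  - by move=> x; rewrite big_ord0.
have p0 (x : 'rV[R]_n) : (0 <= (\prod_i rho (lift ord0 i) (x ord0 i))%:E)%E.
  by rewrite lee_fin; apply: prodr_ge0.
rewrite integral_lebesgue_rVS; last 2 first.
- by mfun.
- by move=> x; rewrite lee_fin; apply: prodr_ge0.
rewrite big_ord_recl -(IH (fun i => rho (lift ord0 i)))//.
rewrite -ge0_integralZr//; last 3 first.
- by mfun.
- by move=> x _; rewrite lee_fin.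
- by apply: integral_ge0 => y _.
apply: eq_integral => s _.
rewrite -ge0_integralZl ?lee_fin//; last by mfun.
apply: eq_integral => y _; rewrite big_ord_recl cons_row0 EFinM.
by under [in LHS]eq_bigr do rewrite cons_rowS.
Qed.

End LebesgueAffine.


(** * Scaling, boxes and Euclidean balls *)

Section LebesgueScaling.
Variable R : realType.
Local Notation leb := (@lebesgue_measure R).
Local Notation lam := (@lebesgue_rV R).

Lemma integral_affine_rV (n : nat) (a b : 'I_n -> R) (f : 'rV[R]_n -> \bar R) :
  (forall i, 0 < a i) -> measurable_fun setT f -> (forall x, 0 <= f x)%E ->
  (\int[lam n]_x f (\row_i (a i * x ord0 i + b i)%R) =
   ((\prod_i a i)^-1)%:E * \int[lam n]_x f x)%E.
Proof.
move=> a0 mf f0.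
rewrite (@integral_coordwise R n (fun i x => a i * x + b i) (fun i _ => (a i)^-1))//.
- rewrite -ge0_integralZl//; last first.
    by rewrite lee_fin invr_ge0 prodr_ge0// => i _; exact: ltW.
  by apply: eq_integral => x _; rewrite prodfV.
- by move=> i; mfun.
- by move=> i _; rewrite invr_ge0 ltW.
- by move=> i h mh h0; exact: integral_lebesgue_affine.
Qed.

Lemma integral_translate_rV (n : nat) (b : 'rV[R]_n) (f : 'rV[R]_n -> \bar R) :
  measurable_fun setT f -> (forall x, 0 <= f x)%E ->
  (\int[lam n]_x f (x + b)%R = \int[lam n]_x f x)%E.
Proof.
move=> mf f0.
have := @integral_affine_rV n (fun=> 1) (fun i => b ord0 i) f (fun=> ltr01) mf f0.
rewrite big1// invr1 mul1e => <-; apply: eq_integral => x _; congr f.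
by apply/rowP => i; rewrite !mxE mul1r.
Qed.

Lemma integral_scale_rV (n : nat) (c : R) (f : 'rV[R]_n -> \bar R) : 0 < c ->
  measurable_fun setT f -> (forall x, 0 <= f x)%E ->
  (\int[lam n]_x f (c *: x)%R = ((c ^+ n)^-1)%:E * \int[lam n]_x f x)%E.
Proof.
move=> c0 mf f0.
have := @integral_affine_rV n (fun=> c) (fun=> 0) f (fun=> c0) mf f0.
rewrite prodr_const card_ord => <-; apply: eq_integral => x _; congr f.
by apply/rowP => i; rewrite !mxE addr0.
Qed.

Lemma volE (n : nat) (A : set 'rV[R]_n) : measurable A -> vol A = lam n A.
Proof.
move=> mA; rewrite /vol iintE ?integral_indic ?setIT//.
by apply/measurable_EFinP; exact: measurable_indic.
Qed.

Definition box (n : nat) (a : 'I_n -> R) : set 'rV[R]_n :=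
  [set x | forall i, `|x ord0 i| <= a i].

Lemma box_indic (n : nat) (a : 'I_n -> R) (x : 'rV[R]_n) :
  \1_(box a) x = \prod_i \1_(`[- a i, a i]%classic) (x ord0 i) :> R.
Proof.
rewrite indicE; case: (boolP (x \in box a)) => [|/negP xa].
  rewrite inE => xa; rewrite big1// => i _.
  by rewrite indicE mem_setE in_itv/= -ler_norml xa.
apply/esym/eqP/prodf_eq0.
have /existsNP[i /negP ai] : ~ forall i, `|x ord0 i| <= a i.
  by move=> xa'; apply: xa; rewrite inE.
by exists i => //; rewrite indicE mem_setE in_itv/= -ler_norml (negbTE ai).
Qed.

Lemma measurable_box (n : nat) (a : 'I_n -> R) : measurable (box a).
Proof.
apply/(@measurable_indicP _ _ R).
pose I i (t : R) : R := \1_(`[- a i, a i]%classic) t.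
have mI i : measurable_fun setT (I i) by exact: measurable_indic.
rewrite (_ : \1_(box a) = fun x => \prod_i I i (x ord0 i)).
  by mfun.
by apply/funext => x; rewrite box_indic.
Qed.

Lemma lebesgue_box (n : nat) (a : 'I_n -> R) : (forall i, 0 <= a i) ->
  lam n (box a) = (\prod_i (2 * a i))%:E.
Proof.
move=> a0; rewrite -[box a]setIT -integral_indic//; last exact: measurable_box.
under eq_integral do rewrite box_indic.
rewrite (@integral_prod_coord R n (fun i => \1_(`[- a i, a i]%classic)))//.
rewrite -prodEFin; apply: eq_bigr => i _.
transitivity (leb `[- a i, a i]%classic); first by rewrite integral_indic// setIT.
rewrite lebesgue_measure_itv/= lte_fin.
have := a0 i; rewrite le_eqVlt => /predU1P[<-|ai].
  by rewrite oppr0 ltxx mulr0.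
by rewrite gtrN// -EFinB opprK mulr_natl mulr2n.
Qed.

Definition enorm (n : nat) (x : 'rV[R]_n) : R := Num.sqrt (\sum_i x ord0 i ^+ 2).

Lemma measurable_enorm (n : nat) : measurable_fun setT (@enorm n).
Proof. by rewrite /enorm; mfun. Qed.

Lemma enorm_ge0 (n : nat) (x : 'rV[R]_n) : 0 <= enorm x.
Proof. exact: sqrtr_ge0. Qed.

Lemma enorm_sqr (n : nat) (x : 'rV[R]_n) : enorm x ^+ 2 = \sum_i x ord0 i ^+ 2.
Proof. by rewrite sqr_sqrtr// sumr_ge0// => i _; exact: sqr_ge0. Qed.

Lemma enorm_dot (n : nat) (x : 'rV[R]_n) : (x *m x^T) ord0 ord0 = enorm x ^+ 2.
Proof. by rewrite enorm_sqr mxE; apply: eq_bigr => i _; rewrite mxE expr2. Qed.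

Lemma enormZ (n : nat) (c : R) (x : 'rV[R]_n) : 0 <= c -> enorm (c *: x) = c * enorm x.
Proof.
move=> c0; rewrite /enorm.
under eq_bigr do rewrite mxE exprMn.
by rewrite -mulr_sumr sqrtrM ?sqr_ge0// sqrtr_sqr ger0_norm.
Qed.

Lemma enorm_cons (n : nat) (s : R) (x : 'rV[R]_n) :
  enorm (cons_row s x) = Num.sqrt (s ^+ 2 + enorm x ^+ 2).
Proof.
rewrite enorm_sqr /enorm big_ord_recl cons_row0.
by under eq_bigr do rewrite cons_rowS.
Qed.

Lemma enorm_eq0 (n : nat) (x : 'rV[R]_n) : (enorm x == 0) = (x == 0).
Proof.
rewrite -sqrf_eq0 enorm_sqr psumr_eq0; last by move=> i _; exact: sqr_ge0.
apply/allP/eqP => [x0|-> i _]; last by rewrite /= mxE expr0n /= eqxx.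
apply/rowP => i; rewrite mxE; apply/eqP.
by have := x0 i (mem_index_enum _); rewrite /= sqrf_eq0.
Qed.

Lemma enorm_entry (n : nat) (x : 'rV[R]_n) i : `|x ord0 i| <= enorm x.
Proof.
rewrite -sqrtr_sqr ler_sqrt ?sumr_ge0//; last by move=> j _; exact: sqr_ge0.
by rewrite (bigD1 i)//= lerDl sumr_ge0// => j _; exact: sqr_ge0.
Qed.

Definition cball (n : nat) (r : R) : set 'rV[R]_n := [set x | enorm x <= r].
Arguments cball : clear implicits.

Lemma measurable_cball (n : nat) (r : R) : measurable (cball n r).
Proof.
have := measurable_fun_ler (@measurable_enorm n) (@measurable_cst _ _ _ R setT r).
by move=> /(_ measurableT [set true] _); rewrite setTI; apply.
Qed.

Lemma eballE (n : nat) : @eball R n = cball n 1.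
Proof.
apply/seteqP; split => x /=; rewrite /eball /cball /= -enorm_sqr.
  by rewrite -[X in _ <= X](expr1n _ 2) ler_pXn2r// ?nnegrE// enorm_ge0.
by move=> x1; rewrite -[X in _ <= X](expr1n _ 2) ler_pXn2r// ?nnegrE// enorm_ge0.
Qed.

Lemma vol_eball (n : nat) : vol (@eball R n) = lam n (cball n 1).
Proof. by rewrite eballE volE//; exact: measurable_cball. Qed.

Lemma lebesgue_cball_lty (n : nat) (r : R) : (lam n (cball n r) < +oo)%E.
Proof.
apply: (@le_lt_trans _ _ (lam n (box (fun=> `|r|)))).
  apply: le_measure; rewrite ?inE; [exact: measurable_cball|exact: measurable_box|].
  move=> x xr i; apply: le_trans (enorm_entry x i) _.
  exact: le_trans xr (ler_norm _).
by rewrite lebesgue_box// ltry.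
Qed.

Lemma lebesgue_cball_gt0 (n : nat) (r : R) : 0 < r -> (0 < lam n (cball n r))%E.
Proof.
(* The cube of half-side [e] lies in the ball because [n e^2 <= (n + 1)^2 e^2 = r^2]; adding 1 keeps
   the denominator positive in dimension 0. *)
move=> r0; pose e := r / (n%:R + 1).
have n0 : 0 < n%:R + 1 :> R by rewrite ltr_wpDl.
have e0 : 0 < e by rewrite divr_gt0.
apply: (@lt_le_trans _ _ (lam n (box (fun=> e)))).
  rewrite lebesgue_box ?lte_fin; last by move=> i; exact: ltW.
  by apply: prodr_gt0 => i _; rewrite mulr_gt0.
apply: le_measure; rewrite ?inE; [exact: measurable_box|exact: measurable_cball|].
move=> x xe; rewrite /cball/=.
rewrite -(@ler_pXn2r _ 2)// ?nnegrE ?enorm_ge0 ?(ltW r0)// enorm_sqr.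
apply: (@le_trans _ _ (\sum_(i < n) e ^+ 2)).
  apply: ler_sum => i _; rewrite -real_normK ?num_real//.
  by rewrite ler_pXn2r ?nnegrE ?normr_ge0 ?(ltW e0)//; exact: xe.
rewrite sumr_const card_ord -[_ *+ n]mulr_natl.
have -> : r = (n%:R + 1) * e by rewrite /e mulrC divfK ?gt_eqF.
rewrite [X in _ <= X]exprMn ler_wpM2r ?sqr_ge0//.
by have := ler0n R n; nra.
Qed.

(** The dimension is a successor because in dimension 0 the origin has mass one. *)
Lemma lebesgue_rV_set0 (n : nat) : lam n.+1 [set 0] = 0%E.
Proof.
have s0 : [set 0] = box (fun=> 0) :> set 'rV[R]_n.+1.
  apply/seteqP; split => x /=; first by move=> -> i; rewrite mxE normr0.
  by move=> x0; apply/rowP => i; rewrite mxE; apply/eqP; rewrite -normr_le0 x0.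
rewrite s0 lebesgue_box//.
by rewrite big_ord_recl mulr0 mul0r.
Qed.

End LebesgueScaling.
Arguments cball {R} n r.


(** * Gaussian integrals and linear forms in Gaussian variables *)

Section Gaussian.
Variable R : realType.
Local Notation leb := (@lebesgue_measure R).
Local Notation lam := (@lebesgue_rV R).

Lemma integral_lebesgueN (f : R -> \bar R) :
  measurable_fun setT f -> (forall x, 0 <= f x)%E ->
  (\int[leb]_x f (- x)%R = \int[leb]_x f x)%E.
Proof.
move=> mf f0.
transitivity (\int[pushforward leb (-%R : _ -> measurableTypeR R)]_x f x)%E.
  by rewrite ge0_integral_pushforward.
by apply: eq_measure_integral => //= A mA _; exact: lebesgue_measureN.
Qed.

Definition gauss_mass : R := Num.sqrt 2 * Num.sqrt pi.

Lemma gauss_mass_gt0 : 0 < gauss_mass.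
Proof. by rewrite mulr_gt0// sqrtr_gt0// pi_gt0. Qed.

Lemma integral_gauss_half :
  (\int[leb]_x (expR (- x ^+ 2 / 2))%:E = gauss_mass%:E)%E.
Proof.
have s0 : 0 < (Num.sqrt 2)^-1 :> R by rewrite invr_gt0 sqrtr_gt0.
have mg : measurable_fun setT (fun x : R => (gauss_fun x)%:E).
  by apply/measurable_EFinP; exact: measurable_gauss_fun.
have := @integral_lebesgue_affine R _ 0 (fun x => (gauss_fun x)%:E) s0 mg
  (fun x => gauss_fun_ge0 x).
rewrite invrK ge0_integralZl//; last by move=> x _; rewrite lee_fin gauss_fun_ge0.
rewrite integralT_gauss /gauss_mass EFinM => <-; apply: eq_integral => x _.
by rewrite /gauss_fun addr0 exprMn exprVn sqr_sqrtr// mulNr [(x ^+ 2 / 2)%R]mulrC.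
Qed.

Definition gauss_density (x : R) : R := gauss_mass^-1 * expR (- x ^+ 2 / 2).

Lemma measurable_gauss_density : measurable_fun setT gauss_density.
Proof. by rewrite /gauss_density; mfun. Qed.
Let mg1 := measurable_gauss_density.

Lemma gauss_density_ge0 x : 0 <= gauss_density x.
Proof. by rewrite mulr_ge0 ?expR_ge0// invr_ge0 ltW// gauss_mass_gt0. Qed.
Let g10 := gauss_density_ge0.

Lemma integral_gauss_density : (\int[leb]_x (gauss_density x)%:E = 1)%E.
Proof.
under eq_integral do rewrite EFinM.
rewrite ge0_integralZl//.
- by rewrite integral_gauss_half -EFinM mulVf// gt_eqF// gauss_mass_gt0.
- by mfun.
- by rewrite lee_fin invr_ge0 ltW// gauss_mass_gt0.
Qed.

Lemma gauss_densityN x : gauss_density (- x) = gauss_density x.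
Proof. by rewrite /gauss_density sqrrN. Qed.

(* Completing the square: the joint exponent is [(c/b)^2 (s - a w / c^2)^2 + w^2 / c^2]. *)
Lemma gauss_conv (a b : R) (h : R -> \bar R) : 0 <= b ->
  measurable_fun setT h -> (forall x, 0 <= h x)%E ->
  (\int[leb]_s ((gauss_density s)%:E *
      \int[leb]_t ((gauss_density t)%:E * h (a * s + b * t)%R)) =
   \int[leb]_r ((gauss_density r)%:E * h (Num.sqrt (a ^+ 2 + b ^+ 2) * r)%R))%E.
Proof.
rewrite le_eqVlt => /predU1P[<-|b0] mh h0.
  (* For [b = 0] the substitution [w = a s + b t] degenerates. The standard deviation is then [|a|],
     and evenness of the density absorbs the sign of [a]. *)
  transitivity (\int[leb]_s ((gauss_density s)%:E * h (a * s)%R))%E.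
    apply: eq_integral => s _; congr (_ * _)%E.
    under eq_integral do rewrite mul0r addr0.
    by rewrite ge0_integralZr//; try iside; rewrite integral_gauss_density mul1e.
  rewrite expr0n addr0 sqrtr_sqr.
  have [a0|a0] := leP 0 a; first by rewrite ger0_norm.
  rewrite ltr0_norm// -[RHS]integral_lebesgueN.
  - by apply: eq_integral => s _; rewrite gauss_densityN mulrNN.
  - by mfun.
  - by move=> x; rewrite mule_ge0// lee_fin.
set c := Num.sqrt _.
have c2 : c ^+ 2 = a ^+ 2 + b ^+ 2 by rewrite sqr_sqrtr// addr_ge0// sqr_ge0.
have c0 : 0 < c by rewrite sqrtr_gt0 ltr_wpDl ?sqr_ge0// exprn_gt0.
have [bn0 cn0] : b != 0 /\ c != 0 by rewrite !gt_eqF.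
transitivity (\int[leb]_s \int[leb]_w
    ((b^-1 * gauss_density s * gauss_density ((w - a * s) / b))%:E * h w))%E.
  apply: eq_integral => s _.
  pose k w := ((gauss_density ((w - a * s) / b))%:E * h w)%E.
  have mk : measurable_fun setT k by rewrite /k; mfun.
  have k0 w : (0 <= k w)%E by rewrite mule_ge0// lee_fin.
  have kE t : k (b * t + a * s) = ((gauss_density t)%:E * h (a * s + b * t)%R)%E.
    by rewrite /k addrK mulrAC divff// mul1r [(b * t + _)%R]addrC.
  under eq_integral do rewrite -kE.
  rewrite (integral_lebesgue_affine _ b0 mk k0) -ge0_integralZl//; try iside.
  apply: eq_integral => w _; rewrite /k !muleA; congr (_ * _)%E.
  by rewrite -!EFinM [(gauss_density s * _)%R]mulrC.
etransitivity; first by apply: (tonelli_curried leb leb); iside.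
pose k w := ((gauss_density (w / c))%:E * h w)%E.
have mk : measurable_fun setT k by rewrite /k; mfun.
have k0 w : (0 <= k w)%E by rewrite mule_ge0// lee_fin.
transitivity (\int[leb]_r k (c * r + 0)%R)%E; last first.
  by apply: eq_integral => r _; rewrite /k addr0 mulrAC divff// mul1r.
rewrite (integral_lebesgue_affine _ c0 mk k0).
apply: eq_integral => w _.
rewrite ge0_integralZr//; try iside.
rewrite /k muleA; congr (_ * _)%E.
pose g s := (gauss_density s)%:E.
have mg : measurable_fun setT g by rewrite /g; mfun.
have g0 s : (0 <= g s)%E by rewrite lee_fin.
have cb0 : 0 < c / b by rewrite divr_gt0.
transitivity (\int[leb]_s ((b^-1 * gauss_density (w / c))%:E *
    g (c / b * s + - (a * w / (b * c)))%R))%E.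
  apply: eq_integral => s _; rewrite /g -EFinM; congr EFin.
  rewrite /gauss_density.
  set m := gauss_mass^-1.
  rewrite [LHS](_ : _ = b^-1 * m * m * (expR (- s ^+ 2 / 2) * expR (- ((w - a * s) / b) ^+ 2 / 2))); last by ring.
  rewrite [RHS](_ : _ = b^-1 * m * m * (expR (- (w / c) ^+ 2 / 2) * expR (- (c / b * s - a * w / (b * c)) ^+ 2 / 2))); last by ring.
  rewrite -!expRD; congr (_ * expR _).
  apply/eqP; rewrite -subr_eq0; apply/eqP.
  transitivity ((2 * b ^+ 2)^-1 * (s ^+ 2 - w ^+ 2 / c ^+ 2) * (c ^+ 2 - (a ^+ 2 + b ^+ 2))).
    by field; rewrite bn0 cn0.
  by rewrite c2 subrr mulr0.
rewrite ge0_integralZl//; try iside.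
rewrite (integral_lebesgue_affine _ cb0 mg g0) ge0_integralZl//; try iside.
rewrite integral_gauss_density mule1 -!EFinM; congr EFin.
by field; rewrite bn0 cn0.
Qed.

(** Adding one coordinate at a time with [gauss_conv] makes the standard deviations combine to
    [|z|]; this replaces an appeal to rotation invariance. *)
Lemma gauss_marginal (d : nat) (z : 'rV[R]_d) (h : R -> \bar R) :
  measurable_fun setT h -> (forall x, 0 <= h x)%E ->
  (\int[lam d]_x ((\prod_i gauss_density (x ord0 i))%R%:E * h (\sum_i z ord0 i * x ord0 i)%R) =
   \int[leb]_t ((gauss_density t)%:E * h (enorm z * t)%R))%E.
Proof.
elim: d z h => [|d IH] z h mh h0.
  rewrite integral_lebesgue_rV0; try iside.
  rewrite !big_ord0 mul1e /enorm big_ord0 sqrtr0.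
  under eq_integral do rewrite mul0r.
  by rewrite ge0_integralZr//; try iside; rewrite integral_gauss_density mul1e.
rewrite integral_lebesgue_rVS; try iside.
pose z' : 'rV[R]_d := \row_i z ord0 (lift ord0 i).
have -> : enorm z = Num.sqrt (z ord0 ord0 ^+ 2 + enorm z' ^+ 2).
  rewrite -enorm_cons; congr enorm.
  apply/rowP => i; case: (unliftP ord0 i) => [j|] ->; first by rewrite cons_rowS mxE.
  by rewrite cons_row0.
rewrite -gauss_conv ?enorm_ge0//; apply: eq_integral => s _.
have mk : measurable_fun setT (fun t => h (z ord0 ord0 * s + t)%R) by mfun.
rewrite -(IH z' (fun t => h (z ord0 ord0 * s + t)%R))//.
rewrite -ge0_integralZl//; try iside.
apply: eq_integral => y _; rewrite muleA -EFinM !big_ord_recl !cons_row0.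
by congr (_%:E * h (_ + _)%R)%E; [congr (_ * _)|]; apply: eq_bigr => i _; rewrite cons_rowS// mxE.
Qed.

End Gaussian.


(** * The Laplace law as a mixture of Gaussians *)

Section LaplaceKernel.
Variable R : realType.
Local Notation leb := (@lebesgue_measure R).
Variable s : R.
Hypothesis s0 : 0 < s.

(** [T u] is the positive root of [x^2 - u x - s = 0]. Hence [F] inverts the increasing map
    [v |-> e^v - s e^(-v)], whose derivative at [F u] is [T u + s / T u = q u]. *)
Let q (u : R) := Num.sqrt (u ^+ 2 + 4 * s).
Let T (u : R) := (u + q u) / 2.
Let F (u : R) := ln (T u).

Let arg_gt0 u : 0 < u ^+ 2 + 4 * s.
Proof. by rewrite ltr_wpDl ?sqr_ge0// mulr_gt0. Qed.

Let q_gt0 u : 0 < q u. Proof. by rewrite sqrtr_gt0. Qed.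

Let q_sqr u : q u ^+ 2 = u ^+ 2 + 4 * s.
Proof. by rewrite sqr_sqrtr// ltW. Qed.

Let q_gt u : `|u| < q u.
Proof. by rewrite -sqrtr_sqr ltr_sqrt// ltrDl mulr_gt0. Qed.

Let T_gt0 u : 0 < T u.
Proof.
rewrite divr_gt0//; have := q_gt u; rewrite ltr_norml => /andP[+ _].
by rewrite -subr_gt0 opprK addrC.
Qed.

Let T_sub u : T u - s / T u = u.
Proof.
have T0 := T_gt0 u; have := q_sqr u.
have Tq : q u = 2 * T u - u by rewrite /T; field.
rewrite Tq => E; have {E}E : s = T u ^+ 2 - u * T u by lra.
rewrite {1}E; field; exact: lt0r_neq0.
Qed.

Let T_add u : T u + s / T u = q u.
Proof.
have T0 := T_gt0 u; have := T_sub u.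
have Tq : q u = 2 * T u - u by rewrite /T; field.
by rewrite Tq; lra.
Qed.

Let expF u : expR (F u) = T u. Proof. by rewrite lnK// posrE. Qed.

Let F_homo : {homo F : x y / (x < y)%R}.
Proof.
move=> x y xy; rewrite ltr_ln ?posrE//.
rewrite ltNge; apply/negP => Tyx.
have : y <= x; last by rewrite leNgt xy.
rewrite -(T_sub x) -(T_sub y) lerB// ler_pM2l//.
by rewrite lef_pV2 ?posrE.
Qed.

Let is_deriveF (u : R) : is_derive u 1 F (q u)^-1.
Proof.
have dq : is_derive u 1 q (u / q u).
  rewrite /q -[X in is_derive _ _ X](_ : Num.sqrt \o (fun u => u ^+ 2 + 4 * s) = _)//.
  apply: is_derive_eq.
    by apply: is_derive1_comp; apply: is_derive1_sqrt.
  by rewrite -/(q u) !scaler1 /=; field; exact: lt0r_neq0.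
have dT : is_derive u 1 T (T u / q u).
  rewrite /T; apply: is_derive_eq.
  rewrite !scaler0 add0r /GRing.scale/=.
  by field; exact: lt0r_neq0.
rewrite /F -[X in is_derive _ _ X](_ : @ln R \o T = _)//.
apply: is_derive_eq.
  by apply: is_derive1_comp; apply: is_derive1_ln.
by have := T_gt0 u; have := q_gt0 u => q0 t0; field; rewrite !lt0r_neq0.
Qed.

Let derF : derive1 F = fun u => (q u)^-1.
Proof. by apply/funext => u; rewrite derive1E; apply: derive_val. Qed.

Let continuous_q : continuous q.
Proof.
rewrite (_ : q = Num.sqrt \o (fun u => u ^+ 2 + 4 * s))// => u.
apply: continuous_comp; last exact: sqrt_continuous.
apply: (@continuousD _ _ _ (fun u : R => u ^+ 2) (fun=> 4 * s)).
  exact: exprn_continuous.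
exact: cst_continuous.
Qed.

(** The prefactor is the derivative of [e^v - s e^(-v)], so the substitution [v = F u] leaves the
    plain Gaussian integral in [u]. *)
Lemma integral_laplace_substitution :
  (\int[leb]_v ((expR v + s * expR (- v)) *
      expR (- (expR v - s * expR (- v)) ^+ 2 / 2))%:E = (gauss_mass R)%:E)%E.
Proof.
rewrite -integral_gauss_half.
pose G v := (expR v + s * expR (- v)) * expR (- (expR v - s * expR (- v)) ^+ 2 / 2).
have cN : continuous (fun v : R => s * expR (- v)).
  move=> v; apply: (@continuousM _ _ (fun=> s) (fun v => expR (- v))).
    exact: cst_continuous.
  apply: (@continuous_comp _ _ _ -%R (@expR R)); first exact: opp_continuous.
  exact: continuous_expR.
have cB : continuous (fun v : R => expR v - s * expR (- v)).
  move=> v; apply: (@continuousB _ _ _ (@expR R) (fun v => s * expR (- v))).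
    exact: continuous_expR.
  exact: cN.
have cG : continuous G.
  move=> v; apply: (@continuousM _ _ (fun v => expR v + s * expR (- v))
    (fun v => expR (- (expR v - s * expR (- v)) ^+ 2 / 2))).
    apply: (@continuousD _ _ _ (@expR R) (fun v => s * expR (- v))).
      exact: continuous_expR.
    exact: cN.
  apply: (@continuous_comp _ _ _ (fun v => expR v - s * expR (- v))
    (fun x => expR (- x ^+ 2 / 2))); first exact: cB.
  apply: (@continuous_comp _ _ _ (fun x : R => - x ^+ 2 / 2) (@expR R));
    last exact: continuous_expR.
  apply: (@continuousM _ _ (fun x : R => - x ^+ 2) (fun=> 2^-1)); last exact: cst_continuous.
  apply: (@continuousN _ _ _ (fun x : R => x ^+ 2)); exact: exprn_continuous.
rewrite (increasing_ge0_integration_by_substitutionT F_homo (G := G)) //.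
- apply: eq_integral => u _; congr EFin; rewrite derF /GRing.mul/= -[LHS]/(G (F u) * (q u)^-1).
  rewrite /G expRN expF T_sub T_add mulrAC divff ?mul1r//; exact: lt0r_neq0.
- by rewrite derF => u; apply: continuousV; [exact: lt0r_neq0|exact: continuous_q].
- apply/cvg_ex; exists 0; rewrite derF; apply/cvgr0Pnorm_le => e e0; near=> u.
  rewrite gtr0_norm ?invr_gt0// -[e]invrK lef_pV2 ?posrE ?invr_gt0//.
  apply: ltW; apply: le_lt_trans (q_gt u); rewrite -normrN.
  apply: le_trans (ler_norm _); rewrite lerNr.
  by near: u; apply: nbhs_ninfty_le; rewrite num_real.
- apply/cvg_ex; exists 0; rewrite derF; apply/cvgr0Pnorm_le => e e0; near=> u.
  rewrite gtr0_norm ?invr_gt0// -[e]invrK lef_pV2 ?posrE ?invr_gt0//.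
  apply: ltW; apply: le_lt_trans (q_gt u).
  apply: le_trans (ler_norm _).
  by near: u; apply: nbhs_pinfty_ge; rewrite num_real.
- by move=> u; have [] := is_deriveF u.
- apply/cvgrNyPle => A; near=> u.
  rewrite -ler_expR expF.
  have uA : u <= - (s / expR A) by near: u; apply: nbhs_ninfty_le; rewrite num_real.
  rewrite leNgt; apply/negP => TA.
  have : s / T u <= s / expR A by rewrite ler_pM2l// lef_pV2 ?posrE ?expR_gt0// ltW.
  by have := T_sub u; have := T_gt0 u; lra.
- apply/cvgryPge => A; near=> u.
  rewrite -ler_expR expF.
  have uA : expR A <= u by near: u; apply: nbhs_pinfty_ge; rewrite num_real.
  have : 0 < s / T u by rewrite divr_gt0.
  by have := T_sub u; lra.
- by move=> v; rewrite /G mulr_ge0 ?expR_ge0// addr_ge0 ?mulr_ge0 ?expR_ge0// ltW.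
Unshelve. all: by end_near. Qed.

(* The reflection [v |-> ln s - v] swaps [expR v] and [s * expR (- v)]. *)
Lemma integral_laplace_half :
  (\int[leb]_v (expR v * expR (- (expR v - s * expR (- v)) ^+ 2 / 2))%:E =
   (gauss_mass R / 2)%:E)%E.
Proof.
pose f v := (expR v * expR (- (expR v - s * expR (- v)) ^+ 2 / 2))%:E.
have mf : measurable_fun setT f by rewrite /f; mfun.
have f0 v : (0 <= f v)%E by rewrite /f; nonneg.
pose g v := (s * expR (- v) * expR (- (expR v - s * expR (- v)) ^+ 2 / 2))%:E.
have mg : measurable_fun setT g by rewrite /g; mfun.
have g0 v : (0 <= g v)%E by rewrite /g; nonneg.
have fg : (\int[leb]_v g v = \int[leb]_v f v)%E.
  have mf' : measurable_fun setT (fun v : R => f (1 * v + ln s)) by mfun.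
  transitivity (\int[leb]_v f (1 * (- v) + ln s)%R)%E; last first.
    apply: (etrans (integral_lebesgueN mf' (fun v => f0 _))).
    apply: (etrans (integral_lebesgue_affine (ln s) ltr01 mf f0)).
    by apply: eq_integral => v _; rewrite invr1 mul1e.
  apply: eq_integral => v _; rewrite /f /g.
  have e1 : expR (1 * - v + ln s) = s * expR (- v).
    by rewrite mul1r expRD lnK ?posrE// mulrC.
  have e2 : s * expR (- (1 * - v + ln s)) = expR v.
    rewrite mul1r opprD opprK expRD [expR (- ln s)]expRN lnK ?posrE//.
    by rewrite mulrCA divff ?mulr1// lt0r_neq0.
  by rewrite e1 e2 -[(expR v - _)%R]opprB sqrrN.
have : (\int[leb]_v f v + \int[leb]_v g v = (gauss_mass R)%:E)%E.
  rewrite -integral_laplace_substitution.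
  apply: (etrans (esym (ge0_integralD leb measurableT (fun v _ => f0 v) mf (fun v _ => g0 v) mg))).
  by apply: eq_integral => v _; rewrite /f /g -EFinD -mulrDl.
(* The two equal integrals have a finite sum, so each is a real number and the equation can be
   halved. *)
rewrite fg -/f; move: (integral_ge0 leb (D := setT) (fun v _ => f0 v)).
set I := (\int[leb]_v f v)%E.
move: I => [r| |]//= _ [] rE.
by congr EFin; rewrite -rE; field.
Qed.

End LaplaceKernel.

Section LaplaceMixture.
Variable R : realType.
Local Notation leb := (@lebesgue_measure R).

(** Density of [v] when [e^v] has the Rayleigh density [r e^(-r^2/2)]; equivalently, the random
    variance [e^(2v)] is exponential with mean 2. *)
Definition mixing_weight (v : R) : R := expR (2 * v - expR (2 * v) / 2).

Lemma measurable_mixing_weight : measurable_fun setT mixing_weight.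
Proof. by rewrite /mixing_weight; mfun. Qed.

Lemma mixing_weight_ge0 v : 0 <= mixing_weight v.
Proof. exact: expR_ge0. Qed.

Definition laplace_density (y : R) : R := expR (- `|y|) / 2.

Lemma measurable_laplace_density : measurable_fun setT laplace_density.
Proof. by rewrite /laplace_density; mfun. Qed.

Lemma laplace_density_ge0 y : 0 <= laplace_density y.
Proof. by rewrite divr_ge0 ?expR_ge0. Qed.

Let mb := measurable_mixing_weight.
Let b0 := mixing_weight_ge0.
Let mg := @measurable_gauss_density R.
Let g0 := @gauss_density_ge0 R.
Let ml := measurable_laplace_density.
Let l0 := laplace_density_ge0.

(** After [w = e^v t] and an exchange of integrals, the exponent is
    [v - |w| - (e^v - |w| e^(-v))^2 / 2]. Integrating over [v] is then [integral_laplace_half] with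
    [s = |w|], which leaves [e^(-|w|) / 2]. *)
Lemma integral_laplace_mixture (h : R -> \bar R) :
  measurable_fun setT h -> (forall x, 0 <= h x)%E ->
  (\int[leb]_v ((mixing_weight v)%:E *
      \int[leb]_t ((gauss_density t)%:E * h (expR v * t)%R)) =
   \int[leb]_y ((laplace_density y)%:E * h y))%E.
Proof.
move=> mh h0.
transitivity (\int[leb]_v \int[leb]_w
    ((mixing_weight v * expR (- v) * gauss_density (w * expR (- v)))%:E * h w))%E.
  apply: eq_integral => v _.
  pose k w := ((gauss_density (w * expR (- v)))%:E * h w)%E.
  have mk : measurable_fun setT k by rewrite /k; mfun.
  have k0 w : (0 <= k w)%E by rewrite /k; nonneg.
  have kE t : k (expR v * t + 0) = ((gauss_density t)%:E * h (expR v * t)%R)%E.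
    by rewrite /k addr0 mulrAC -expRD subrr expR0 mul1r.
  under eq_integral do rewrite -kE.
  rewrite (integral_lebesgue_affine _ (expR_gt0 v) mk k0) -ge0_integralZl//; try iside.
  apply: eq_integral => w _; rewrite /k !muleA -expRN; congr (_ * _)%E.
pose K w := (\int[leb]_v
  ((mixing_weight v * expR (- v) * gauss_density (w * expR (- v)))%:E * h w))%E.
have mK : measurable_fun setT K by rewrite /K; mfun; nonneg.
transitivity (\int[leb]_w K w)%E.
  by apply: (tonelli_curried leb leb); iside.
have mr : measurable_fun setT (fun y => ((laplace_density y)%:E * h y)%E) by mfun.
(* The kernel computation requires [|w| > 0], so the null point [w = 0] is removed. *)
have m0 : measurable ([set: R] `\ 0) by exact: measurableD.
rewrite -(@integral_setD1 R K 0 setT m0 (measurable_funTS mK)).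
rewrite -(@integral_setD1 R _ 0 setT m0 (measurable_funTS mr)).
apply: eq_integral => w; rewrite inE => -[_ /= /eqP w0].
rewrite /K ge0_integralZr//; try iside.
congr (_ * _)%E.
have s0 : 0 < `|w| by rewrite normr_gt0.
transitivity (\int[leb]_v (((gauss_mass R)^-1 * expR (- `|w|))%:E *
   (expR v * expR (- (expR v - `|w| * expR (- v)) ^+ 2 / 2))%:E))%E.
  apply: eq_integral => v _; rewrite -EFinM; congr EFin.
  rewrite /mixing_weight /gauss_density.
  rewrite [LHS](_ : _ = (gauss_mass R)^-1 * (expR (2 * v - expR (2 * v) / 2) * expR (- v) *
    expR (- (w * expR (- v)) ^+ 2 / 2))); last by ring.
  rewrite [RHS](_ : _ = (gauss_mass R)^-1 * (expR (- `|w|) * expR v *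
    expR (- (expR v - `|w| * expR (- v)) ^+ 2 / 2))); last by ring.
  rewrite -!expRD; congr (_ * expR _).
  have -> : expR (2 * v) = expR v ^+ 2 by rewrite expRM_natl.
  have vv : expR v * expR (- v) = 1 by rewrite -expRD subrr expR0.
  have ww : w ^+ 2 = `|w| ^+ 2 by rewrite real_normK ?num_real.
  rewrite exprMn ww.
  apply/eqP; rewrite -subr_eq0; apply/eqP.
  transitivity (`|w| * (1 - expR v * expR (- v))); first by field.
  by rewrite vv subrr mulr0.
rewrite ge0_integralZl//; last 2 first.
- by mfun.
- by rewrite lee_fin mulr_ge0 ?expR_ge0// invr_ge0 ltW// gauss_mass_gt0.
rewrite integral_laplace_half// -EFinM /laplace_density; congr EFin.
by field; rewrite gt_eqF// gauss_mass_gt0.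
Qed.

End LaplaceMixture.


(** * Random matrices with Laplace marginals *)

Section RandomMatrix.
Variable R : realType.
Local Notation leb := (@lebesgue_measure R).
Local Notation lam := (@lebesgue_rV R).
Let mb := @measurable_mixing_weight R.
Let b0 := @mixing_weight_ge0 R.
Let mg := @measurable_gauss_density R.
Let g0 := @gauss_density_ge0 R.
Let ml := @measurable_laplace_density R.
Let l0 := @laplace_density_ge0 R.

(** A pair [p = (v, x)] encodes the random column [e^v x], and this is the joint density of [v] and
    [x]. *)
Definition column_weight (d : nat) (p : R * 'rV[R]_d) : R :=
  mixing_weight p.1 * \prod_i gauss_density (p.2 ord0 i).

Lemma measurable_column_weight d : measurable_fun setT (@column_weight d).
Proof. by rewrite /column_weight; mfun. Qed.

Lemma column_weight_ge0 d p : 0 <= @column_weight d p.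
Proof. by rewrite /column_weight; nonneg. Qed.

Definition column_dot (d : nat) (z : 'rV[R]_d) (p : R * 'rV[R]_d) : R :=
  expR p.1 * \sum_i z ord0 i * p.2 ord0 i.

Lemma measurable_column_dot d z : measurable_fun setT (@column_dot d z).
Proof. by rewrite /column_dot; mfun. Qed.

(** For fixed [v] the scalar product is [e^v |z|] times a standard Gaussian; mixing over [v] turns
    it into [|z|] times a Laplace variable. *)
Lemma integral_column (d : nat) (z : 'rV[R]_d) (h : R -> \bar R) :
  measurable_fun setT h -> (forall x, 0 <= h x)%E ->
  (\int[prod_sigma_finite leb (lam d)]_p ((column_weight p)%:E * h (column_dot z p)) =
   \int[leb]_y ((laplace_density y)%:E * h (enorm z * y)%R))%E.
Proof.
move=> mh h0.
have mh2 : measurable_fun setT (fun y => h (enorm z * y)%R) by mfun.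
apply: (etrans _ (integral_laplace_mixture mh2 (fun y => h0 _))).
pose f (v : R) (x : 'rV[R]_d) :=
  ((column_weight (v, x))%:E * h (column_dot z (v, x)))%E.
have mf : measurable_fun setT (fun p : R * 'rV[R]_d => f p.1 p.2).
  by rewrite /f /column_weight /column_dot /=; mfun.
have f0 v x : (0 <= f v x)%E by rewrite /f mule_ge0// lee_fin column_weight_ge0.
transitivity (\int[leb]_v \int[lam d]_x f v x)%E.
  apply: (etrans _ (integral_prod_curried leb (lam d) mf f0)).
  by apply: eq_integral => -[].
apply: eq_integral => v _.
have mhv : measurable_fun setT (fun u => h (expR v * u)%R) by mfun.
transitivity (\int[lam d]_x ((mixing_weight v)%:E * ((\prod_i gauss_density (x ord0 i))%R%:E *
    h (expR v * (\sum_i z ord0 i * x ord0 i))%R)))%E.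
  by apply: eq_integral => x _; rewrite /f /column_weight /= EFinM muleA.
rewrite ge0_integralZl//; try iside.
congr (_ * _)%E; apply: (etrans (gauss_marginal z mhv (fun u => h0 _))).
by apply: eq_integral => t _; congr (_ * h _)%E; ring.
Qed.

(* The columns are independent copies of [expR v *: x], [x] a standard Gaussian
   vector: conditionally on [v], the law of [z *m x^T] depends on [z] only through
   its Euclidean norm. *)
Lemma random_matrix_exists (d n : nat) :
  exists (disp : measure_display) (T : measurableType disp)
    (mu : {sigma_finite_measure set T -> \bar R}) (w : T -> R) (G : T -> 'M[R]_(d, n)),
  [/\ measurable_fun setT w, measurable_fun setT G, forall t, 0 <= w t &
    forall (z : 'rV[R]_d) (h : 'rV[R]_n -> \bar R),
      measurable_fun setT h -> (forall x, 0 <= h x)%E ->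
      (\int[mu]_t ((w t)%:E * h (z *m G t)%R) =
       \int[lam n]_y ((\prod_i laplace_density (y ord0 i))%R%:E * h (enorm z *: y)%R))%E].
Proof.
elim: n => [|n [disp [T [mu [w [G [mw mG w0 wG]]]]]]].
  exists _, _, (lam 0), (fun=> 1), (fun=> 0); split => //.
  move=> z h mh h0; rewrite !integral_lebesgue_rV0//; try iside.
  by rewrite big_ord0 !mul1e; congr h; rewrite [LHS]thinmx0 [RHS]thinmx0.
pose G1 (p : (R * 'rV[R]_d) * T) : 'M[R]_(d, n.+1) :=
  row_mx (expR p.1.1 *: (p.1.2)^T) (G p.2) : 'M[R]_(d, 1 + n).
pose w1 (p : (R * 'rV[R]_d) * T) : R := column_weight p.1 * w p.2.
have mcw := @measurable_column_weight d.
have mcd := @measurable_column_dot d.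
have cw0 := @column_weight_ge0 d.
exists _, _, (prod_sigma_finite (prod_sigma_finite leb (lam d)) mu), w1, G1; split.
- by rewrite /w1; mfun.
- by rewrite /G1; apply: (@measurable_row_mx R _ _ d 1 n); mfun.
- by move=> p; rewrite /w1; nonneg.
move=> z h mh h0.
have mzG : measurable_fun setT (fun t => z *m G t) by mfun.
pose f (a : R * 'rV[R]_d) (t : T) :=
  ((column_weight a * w t)%:E * h (cons_row (column_dot z a) (z *m G t)))%E.
have mf : measurable_fun setT (fun p : (R * 'rV[R]_d) * T => f p.1 p.2).
  by rewrite /f; mfun; exact: (mcd z).
have f0 a t : (0 <= f a t)%E by rewrite /f; nonneg.
transitivity (\int[prod_sigma_finite leb (lam d)]_a \int[mu]_t f a t)%E.
  apply: (etrans _ (integral_prod_curried (prod_sigma_finite leb (lam d)) mu mf f0)).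
  apply: eq_integral => -[[v x] t] _; rewrite /f /w1; congr (_ * h _)%E.
  have E : z *m (expR v *: x^T) = (column_dot z (v, x))%:M.
    apply/matrixP => i j; rewrite !ord1 !mxE eqxx mulr1n /column_dot mulr_sumr.
    by apply: eq_bigr => k _; rewrite !mxE /=; ring.
  by rewrite /G1 /= (@mul_mx_row R 1 d 1 n) E.
(* Integrating out the old columns by the induction hypothesis leaves a function of the new
   coordinate alone, to which [integral_column] applies. *)
pose H u := (\int[lam n]_y ((\prod_i laplace_density (y ord0 i))%R%:E *
  h (cons_row u (enorm z *: y))))%E.
have mH : measurable_fun setT H by rewrite /H; mfun; nonneg.
have H0 u : (0 <= H u)%E by rewrite /H; nonneg.
transitivity (\int[prod_sigma_finite leb (lam d)]_a
    ((column_weight a)%:E * H (column_dot z a)))%E.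
  apply: eq_integral => a _.
  have mk : measurable_fun setT (fun y => h (cons_row (column_dot z a) y)) by mfun.
  rewrite /H; apply: (etrans _ (congr1 (mule _) (wG z _ mk (fun y => h0 _)))).
  rewrite -ge0_integralZl//; try iside.
  by apply: eq_integral => t _; rewrite /f EFinM muleA.
apply: (etrans (integral_column z mH H0)).
apply: esym; apply: etrans; first by apply: integral_lebesgue_rVS; iside.
apply: eq_integral => s _.
rewrite /H -ge0_integralZl//; try iside.
apply: eq_integral => y _; rewrite muleA -EFinM big_ord_recl cons_row0.
congr (_%:E * h _)%E.
  by congr (_ * _); apply: eq_bigr => i _; rewrite cons_rowS.
apply/rowP => i; rewrite [LHS]mxE; case: (unliftP ord0 i) => [j|] ->.
  by rewrite !cons_rowS [RHS]mxE.
by rewrite !cons_row0.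
Qed.

End RandomMatrix.


(** * From bounds on sections to weighted integrals *)

Section SectionTransfer.
Variable R : realType.
Local Notation lam := (@lebesgue_rV R).

Definition l1norm (n : nat) (x : 'rV[R]_n) : R := \sum_i `|x ord0 i|.

Lemma measurable_l1norm n : measurable_fun setT (@l1norm n).
Proof. by rewrite /l1norm; mfun. Qed.

Lemma l1norm_ge0 n (x : 'rV[R]_n) : 0 <= l1norm x.
Proof. by rewrite sumr_ge0. Qed.

Lemma l1normZ n (c : R) (x : 'rV[R]_n) : 0 <= c -> l1norm (c *: x) = c * l1norm x.
Proof.
move=> c0; rewrite /l1norm mulr_sumr; apply: eq_bigr => i _.
by rewrite mxE normrM ger0_norm.
Qed.

Lemma l1norm_eq0 n (x : 'rV[R]_n) : (l1norm x == 0) = (x == 0).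
Proof.
rewrite psumr_eq0//; apply/allP/eqP => [x0|-> i _]; last by rewrite /= mxE normr0 eqxx.
apply/rowP => i; rewrite mxE; apply/eqP.
by have := x0 i (mem_index_enum _); rewrite /= normr_eq0.
Qed.

Lemma measurable_set0_rV n : measurable [set 0 : 'rV[R]_n].
Proof.
rewrite (_ : [set 0] = box (fun=> 0)); first exact: measurable_box.
apply/seteqP; split => x /=; first by move=> -> i; rewrite mxE normr0.
by move=> x0; apply/rowP => i; rewrite mxE; apply/eqP; rewrite -normr_le0 x0.
Qed.

(** For identities that break down at the origin, where a norm is inverted. *)
Lemma integral_rV_neq0 n (f g : 'rV[R]_n -> \bar R) : (0 < n)%N ->
  measurable_fun setT f -> measurable_fun setT g ->
  (forall x, 0 <= f x)%E -> (forall x, 0 <= g x)%E ->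
  (forall x, x != 0 -> f x = g x) ->
  (\int[lam n]_x f x = \int[lam n]_x g x)%E.
Proof.
case: n f g => // n f g _ mf mg f0 g0 fg; apply: ge0_ae_eq_integral => //.
exists [set 0]; split; [exact: measurable_set0_rV|exact: lebesgue_rV_set0|].
move=> x /= /not_implyP[_ fgx]; apply: contrapT => /eqP x0.
by apply: fgx; exact: fg.
Qed.

(** For [z] spread by Lebesgue measure on R^d and [y] a Laplace vector, [2^-n omega(|x|_1)] is the
    density at [x] of the image measure of [|z| y]. *)
Definition omega (d n : nat) (s : R) : \bar R :=
  (\int[lam d]_z ((enorm z ^+ n)^-1 * expR (- (s / enorm z)))%:E)%E.

Let ml1 := @measurable_laplace_density R.
Let l0 := @laplace_density_ge0 R.

Lemma omega_ge0 d n s : (0 <= omega d n s)%E.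
Proof. by rewrite /omega; nonneg; exact: enorm_ge0. Qed.

Lemma measurable_omega d n : measurable_fun setT (omega d n).
Proof.
rewrite /omega; apply: (measurable_integralr (lam d)) => /=; last by nonneg; exact: enorm_ge0.
by have md := @measurable_enorm R d; mfun.
Qed.

Lemma integral_laplace_scaled (n : nat) (r : R) (phi : 'rV[R]_n -> \bar R) : 0 < r ->
  measurable_fun setT phi -> (forall x, 0 <= phi x)%E ->
  (\int[lam n]_y ((\prod_i laplace_density (y ord0 i))%R%:E * phi (r *: y)%R) =
   \int[lam n]_x (((2 ^+ n)^-1)%:E *
     (((r ^+ n)^-1 * expR (- (l1norm x / r)))%R%:E * phi x)))%E.
Proof.
move=> r0 mphi phi0.
pose f (x : 'rV[R]_n) := ((\prod_i laplace_density (x ord0 i / r))%R%:E * phi x)%E.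
have mf : measurable_fun setT f by rewrite /f; mfun.
have f0 x : (0 <= f x)%E by rewrite /f; nonneg.
transitivity (\int[lam n]_y f (r *: y))%E.
  apply: eq_integral => y _; rewrite /f; congr (_%:E * _)%E; apply: eq_bigr => i _.
  by rewrite mxE mulrAC divff ?mul1r// gt_eqF.
apply: (etrans (integral_scale_rV r0 mf f0)).
rewrite -ge0_integralZl//; try iside.
apply: eq_integral => x _; rewrite /f !muleA; congr (_ * _)%E.
rewrite -!EFinM; congr EFin; rewrite mulrCA; congr (_ * _).
rewrite /laplace_density big_split/= prodr_const card_ord -exprVn mulrC; congr (_ * _).
rewrite -expR_sum; congr expR; rewrite sumrN /l1norm mulr_suml; congr (- _).
by apply: eq_bigr => i _; rewrite normrM normfV (gtr0_norm r0).
Qed.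

Lemma section_transfer (d n : nat) (phi chi : 'rV[R]_n -> \bar R) (K : R) :
  (0 < d)%N -> 0 <= K ->
  measurable_fun setT phi -> measurable_fun setT chi ->
  (forall x, 0 <= phi x)%E -> (forall x, 0 <= chi x)%E ->
  (forall G : 'M[R]_(d, n),
     (\int[lam d]_z phi (z *m G) <= K%:E * \int[lam d]_z chi (z *m G))%E) ->
  (\int[lam n]_x (omega d n (l1norm x) * phi x) <=
   K%:E * \int[lam n]_x (omega d n (l1norm x) * chi x))%E.
Proof.
case: d => // d _ K0 mphi mchi phi0 chi0 H.
have [disp [T [mu [w [G [mw mG w0 wG]]]]]] := random_matrix_exists R d.+1 n.
have md := @measurable_enorm R d.+1; have mln := @measurable_l1norm n.
have mom := @measurable_omega d.+1 n.
have om0 := omega_ge0 d.+1 n.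
(* [key] evaluates the average over [G]. Applied to [phi] and to [chi] it yields the same factor
   [2^-n], which cancels from the averaged hypothesis. *)
suff key psi : measurable_fun setT psi -> (forall x, 0 <= psi x)%E ->
    (((2 ^+ n)^-1)%:E * \int[lam n]_x (omega d.+1 n (l1norm x) * psi x) =
     \int[mu]_t ((w t)%:E * \int[lam d.+1]_z psi (z *m G t)%R))%E.
  have c0 : 0 < (2 ^+ n)^-1 :> R by rewrite invr_gt0 exprn_gt0.
  rewrite -(@lee_pmul2l _ ((2 ^+ n)^-1)%:E)// muleCA !key//.
  rewrite -ge0_integralZl//; try iside.
  apply: ge0_le_integral => //; try iside.
  by move=> t _; rewrite muleCA lee_wpmul2l// lee_fin.
move=> mpsi psi0.
transitivity (\int[mu]_t \int[lam d.+1]_z ((w t)%:E * psi (z *m G t)%R))%E; last first.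
  by apply: eq_integral => t _; rewrite ge0_integralZl//; iside.
apply: esym; etransitivity; first by apply: (tonelli_curried mu (lam d.+1)); iside.
pose f (z : 'rV[R]_d.+1) (x : 'rV[R]_n) := (((2 ^+ n)^-1)%:E *
  (((enorm z ^+ n)^-1 * expR (- (l1norm x / enorm z)))%R%:E * psi x))%E.
have mf : measurable_fun setT (fun p : 'rV[R]_d.+1 * 'rV[R]_n => f p.1 p.2) by rewrite /f; mfun.
have en0 := @enorm_ge0 R d.+1.
have f0 z x : (0 <= f z x)%E by rewrite /f; nonneg.
transitivity (\int[lam d.+1]_z \int[lam n]_x f z x)%E.
  (* The density of [|z| y] requires [|z| > 0]; the origin is null since the dimension is
     positive. *)
  apply: integral_rV_neq0; first by [].
  - by apply: (measurable_integralr mu (f := fun z t => ((w t)%:E * psi (z *m G t))%E)); iside.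
  - exact: measurable_integralr.
  - by nonneg.
  - by nonneg.
  - move=> z z0; apply: (etrans (wG z psi mpsi psi0)).
    by apply: integral_laplace_scaled => //; rewrite lt_neqAle eq_sym enorm_eq0 z0 enorm_ge0.
apply: (etrans (tonelli_curried (lam d.+1) (lam n) mf f0)).
rewrite -ge0_integralZl//; try iside.
apply: eq_integral => x _; rewrite /f /omega.
rewrite ge0_integralZl//; try iside.
by congr (_ * _)%E; rewrite ge0_integralZr//; iside.
Qed.

End SectionTransfer.


(** * Exponential integrals and the layer-cake formula *)

Section ExponentialIntegrals.
Variable R : realType.
Local Notation leb := (@lebesgue_measure R).

Lemma integral_exp_tail (k v0 : R) : 0 < k ->
  (\int[leb]_v ((v0 <= v)%R%:R * (k * expR (- (k * v))))%:E = (expR (- (k * v0)))%:E)%E.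
Proof.
move=> k0.
pose f v := k * expR (- (k * v)).
pose F v := - expR (- (k * v)).
have cE : continuous (fun v => expR (- (k * v))).
  move=> v; apply: (@continuous_comp _ _ _ (fun v => - (k * v)) (@expR R));
    last exact: continuous_expR.
  by apply: (@continuousN _ _ _ (fun v => k * v)); exact: mulrl_continuous.
have cF : continuous F.
  by move=> v; apply: (@continuousN _ _ _ (fun v => expR (- (k * v)))); exact: cE.
have cf : continuous f.
  by move=> v; apply: (@continuousM _ _ (fun=> k) (fun v => expR (- (k * v))));
    [exact: cst_continuous|exact: cE].
have dF (v : R) : is_derive v 1 F (f v).
  have dk : is_derive v 1 (fun v : R => - (k * v)) (- k).
    by apply: is_derive_eq; rewrite /GRing.scale/= ?mulr1 ?mulr0 ?addr0 ?add0r.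
  have dE := @is_derive1_comp R (@expR R) (fun v => - (k * v)) v _ _
    (is_derive_expR (- (k * v))) dk.
  rewrite (_ : F = - (@expR R \o (fun v => - (k * v))))//.
  by apply: is_derive_eq; rewrite /f; ring.
transitivity (\int[leb]_(v in `[v0, +oo[) (f v)%:E)%E.
  rewrite [RHS]integral_mkcond; apply: eq_integral => v _.
  rewrite patchE mem_setE in_itv/= andbT.
  by case: (v0 <= v); rewrite ?mul1r ?mul0r.
rewrite (@ge0_continuous_FTC2y R f F v0 0)//.
- by rewrite sub0e /F EFinN oppeK.
- by move=> v _; rewrite /f mulr_ge0 ?expR_ge0// ltW.
- exact: continuous_subspaceT.
- apply/cvgr0Pnorm_le => e e0.
  apply: (filterS (P := fun v => k^-1 * - ln e <= v)).
    move=> v; rewrite ler_pdivrMl// => ev.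
    by rewrite /F normrN gtr0_norm ?expR_gt0// -[e]lnK ?posrE// ler_expR lerNl.
  by apply: nbhs_pinfty_ge; rewrite num_real.
- by apply: cvg_at_right_filter; exact: cF.
- by move=> v _; rewrite derive1E; apply: derive_val.
Qed.

Lemma integral_exp_head (k v0 : R) : 0 < k ->
  (\int[leb]_v ((v <= v0)%R%:R * (k * expR (k * v)))%:E = (expR (k * v0))%:E)%E.
Proof.
move=> k0; have := integral_exp_tail (- v0) k0; rewrite mulrN opprK => <-.
have mf : measurable_fun setT (fun v : R => ((- v0 <= v)%R%:R * (k * expR (- (k * v))))%:E).
  by mfun.
apply: (etrans _ (integral_lebesgueN mf _)); last by nonneg.
by apply: eq_integral => v _; rewrite lerN2 mulrN opprK.
Qed.

(** The level is parametrized as [e^v], so that powers of the level become exponentials in [v] and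
    every later integral is an exponential tail or head. *)
Lemma layer_cake (k : nat) (r : R) : (0 < k)%N -> 0 < r ->
  (\int[leb]_v ((r <= expR v)%R%:R * (k%:R * expR (- (k%:R * v))))%:E = ((r ^+ k)^-1)%:E)%E.
Proof.
move=> k0 r0; have k0' : 0 < k%:R :> R by rewrite ltr0n.
have := integral_exp_tail (ln r) k0'.
rewrite expRN expRM_natl lnK ?posrE// => <-.
apply: eq_integral => v _; congr ((_%:R * _)%:E).
by rewrite -{1}[r]lnK ?posrE// ler_expR.
Qed.

End ExponentialIntegrals.

(** * Homogeneity, finiteness and integral bounds for [omega] *)

Section OmegaEstimates.
Variable R : realType.
Local Notation leb := (@lebesgue_measure R).
Local Notation lam := (@lebesgue_rV R).

Lemma integral_homogeneous_ball (n : nat) (N : 'rV[R]_n -> R) (c s : R) :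
  measurable_fun setT N -> (forall c x, 0 <= c -> N (c *: x) = c * N x) -> 0 < c ->
  (\int[lam n]_x ((N x <= c * s)%R%:R)%:E =
   (c ^+ n)%:E * \int[lam n]_x ((N x <= s)%R%:R)%:E)%E.
Proof.
move=> mN NZ c0; have c0' : 0 < c^-1 by rewrite invr_gt0.
have mf : measurable_fun setT (fun x => ((N x <= s)%R%:R)%:E : \bar R) by mfun.
have := integral_scale_rV c0' mf; rewrite exprVn invrK => <-; last by nonneg.
apply: eq_integral => x _; congr (_%:R%:E).
by rewrite NZ ?(ltW c0')// ler_pdivrMl.
Qed.

Lemma omega_le (d n : nat) (s t : R) : s <= t -> (omega d n t <= omega d n s)%E.
Proof.
move=> st; have md := @measurable_enorm R d; have en0 := @enorm_ge0 R d.
rewrite /omega; apply: ge0_le_integral => //; try iside.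
move=> z _; rewrite lee_fin ler_wpM2l//; first by nonneg.
by rewrite ler_expR lerN2 ler_wpM2r// invr_ge0.
Qed.

(** Replacing [z] by [c z] contributes [c^d] from the measure and [c^-(d + k)] from the power of the
    norm. *)
Lemma omega_scale (d k : nat) (c s : R) : 0 < c ->
  omega d (d + k) (c * s) = (((c ^+ k)^-1)%:E * omega d (d + k) s)%E.
Proof.
move=> c0; have md := @measurable_enorm R d; have en0 := @enorm_ge0 R d.
pose f (z : 'rV[R]_d) : \bar R :=
  ((enorm z ^+ (d + k))^-1 * expR (- (c * s / enorm z)))%:E.
have mf : measurable_fun setT f by rewrite /f; mfun.
have f0 z : (0 <= f z)%E by rewrite /f; nonneg.
have E := integral_scale_rV c0 mf f0.
have E2 : (\int[lam d]_z f (c *: z)%R = ((c ^+ (d + k))^-1)%:E * omega d (d + k) s)%E.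
  rewrite /omega -ge0_integralZl//; try iside.
  apply: eq_integral => z _; rewrite /f -EFinM enormZ ?ltW//; congr EFin.
  (* At the origin the convention [0^-1 = 0] turns both exponentials into 1, so the identity
     persists. *)
  have [z0|z0] := eqVneq (enorm z) 0.
    by rewrite z0 mulr0 invr0 !mulr0 !oppr0 mulrA -invfM -exprMn mulr0.
  rewrite exprMn invfM mulrA; congr (_ * expR (- _)).
  by field; rewrite z0 gt_eqF.
rewrite -[LHS]/(\int[lam d]_z f z)%E.
have -> : (\int[lam d]_z f z = (c ^+ d)%:E * (((c ^+ d)^-1)%:E * \int[lam d]_z f z))%E.
  by rewrite muleA -EFinM divff ?mul1e// expf_neq0// gt_eqF.
rewrite -E E2 muleA -EFinM exprD; congr (_%:E * _)%E.
by field; rewrite !expf_neq0// gt_eqF.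
Qed.

(** The integrand is positive off the origin; were its integral zero, the unit ball would be
    null. *)
Lemma omega_gt0 (d n : nat) (s : R) : (0 < omega d.+1 n s)%E.
Proof.
rewrite lt_neqAle omega_ge0 andbT eq_sym; apply/eqP => om0.
have md := @measurable_enorm R d.+1; have en0 := @enorm_ge0 R d.+1.
pose f (z : 'rV[R]_d.+1) : \bar R := ((enorm z ^+ n)^-1 * expR (- (s / enorm z)))%:E.
have mf : measurable_fun setT f by rewrite /f; mfun.
have f0 z : (0 <= f z)%E by rewrite /f; nonneg.
have /(ae_eq_integral_abs (lam d.+1) measurableT mf) [N [mN N0 Nf]] :
    (\int[lam d.+1]_z `|f z| = 0)%E.
  by rewrite -om0; apply: eq_integral => z _; rewrite gee0_abs.
have := lebesgue_cball_gt0 d.+1 (@ltr01 R); rewrite ltNge => /negP; apply.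
apply: (@le_trans _ _ (lam d.+1 (N `|` [set 0]))).
  apply: le_measure; rewrite ?inE; [exact: measurable_cball| |].
    by apply: measurableU => //; exact: measurable_set0_rV.
  move=> z _; have [->|z0] := eqVneq z 0; [by right|left].
  apply: Nf => /= fz0; have := fz0 I => -[] /eqP; apply/negP.
  by rewrite mulf_neq0 ?gt_eqF ?expR_gt0// invr_gt0 exprn_gt0// lt_neqAle eq_sym enorm_eq0 z0 en0.
apply: (@le_trans _ _ (lam d.+1 N + lam d.+1 [set 0%R])%E).
  by apply: measureU2 => //; exact: measurable_set0_rV.
by rewrite N0 lebesgue_rV_set0 adde0.
Qed.

(** The integrand is at most [max(1, |z|)^-n]. Its layers are balls of volume [b e^(d v)] with
    weight [n e^(-n v)] on [v >= 0], and the product [b n e^(-k v)] is integrable because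
    [k > 0]. *)
Lemma omega_lty (d k : nat) : (0 < k)%N -> (omega d (d + k) (d + k)%:R < +oo :> \bar R)%E.
Proof.
move=> k0; set n := (d + k)%N.
have n0 : (0 < n)%N by rewrite addn_gt0 k0 orbT.
have n0' : 0 < n%:R :> R by rewrite ltr0n.
have md := @measurable_enorm R d; have en0 := @enorm_ge0 R d.
pose F (z : 'rV[R]_d) (v : R) : \bar R :=
  (((enorm z <= expR v)%R%:R * (0 <= v)%R%:R) * (n%:R * expR (- (n%:R * v))))%:E.
have mF : measurable_fun setT (fun p : 'rV[R]_d * R => F p.1 p.2) by rewrite /F; mfun.
have F0 z v : (0 <= F z v)%E by rewrite /F; nonneg.
have fF z : (((enorm z ^+ n)^-1 * expR (- (n%:R / enorm z)))%:E <= \int[leb]_v F z v)%E.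
  have [z0|z0] := eqVneq (enorm z) 0.
    by rewrite z0 expr0n gtn_eqF// invr0 mul0r; nonneg.
  have r0 : 0 < enorm z by rewrite lt_neqAle eq_sym z0 en0.
  (* For [|z| <= 1] the bound is the [n]-th power of [t e^(-t) <= 1] with [t = 1/|z|], which matches
     the argument [n] of [omega]; for [|z| > 1] the exponential is at most 1. *)
  pose m := Num.max 1 (enorm z).
  have m0 : 0 < m by rewrite lt_max ltr01.
  rewrite (_ : (\int[leb]_v F z v = ((m ^+ n)^-1)%:E)%E); last first.
    rewrite -(layer_cake n0 m0); apply: eq_integral => v _; rewrite /F.
    have v1 : (1 <= expR v) = (0 <= v) by rewrite -[X in X <= _](@expR0 R) ler_expR.
    rewrite /m ge_max v1 andbC.
    by case: (enorm z <= expR v); case: (0 <= v); rewrite ?mulr1 ?mulr0 ?mul0r.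
  rewrite lee_fin /m; have [z1|z1] := leP (enorm z) 1; last first.
    rewrite ger_pMr ?invr_gt0 ?exprn_gt0// -[X in _ <= X](@expR0 R) ler_expR oppr_le0.
    by rewrite divr_ge0// ltW.
  rewrite expr1n invr1 expRN expRM_natl -exprVn -exprVn -exprMn.
  rewrite exprn_ile1//; first by nonneg.
  rewrite -invfM invf_le1 ?mulr_gt0 ?expR_gt0//.
  rewrite -ler_pdivrMl// mulr1; apply: le_trans (expR_ge1Dx _).
  by rewrite lerDr.
apply: (@le_lt_trans _ _ (\int[lam d]_z \int[leb]_v F z v)%E).
  by rewrite /omega; apply: ge0_le_integral => //; iside.
rewrite (tonelli_curried (lam d) leb mF F0).
have [b bE] : exists b : R, (\int[lam d]_z ((enorm z <= 1)%R%:R)%:E = b%:E)%E.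
  have := lebesgue_cball_lty d (1 : R).
  rewrite -[cball d 1]setIT -integral_indic//; last exact: measurable_cball.
  rewrite (_ : (\int[lam d]_z (\1_(cball d 1) z)%:E =
    \int[lam d]_z ((enorm z <= 1)%R%:R)%:E)%E); last first.
    apply: eq_integral => z _; rewrite indicE.
    by case: (boolP (enorm z <= 1)) => zr; [rewrite mem_set|rewrite memNset//; exact/negP].
  have : (0 <= \int[lam d]_z ((enorm z <= 1)%R%:R)%:E :> \bar R)%E by nonneg.
  by case: (integral _ _ _) => [b| |]//; exists b.
have b0 : 0 <= b by rewrite -lee_fin -bE; nonneg.
have kk : 0 < k%:R :> R by rewrite ltr0n.
rewrite (_ : (\int[leb]_v \int[lam d]_z F z v)%E =
  (\int[leb]_v ((b * n%:R / k%:R)%:E * ((0 <= v)%R%:R * (k%:R * expR (- (k%:R * v))))%:E))%E); last first.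
  apply: eq_integral => v _; rewrite /F.
  transitivity (\int[lam d]_z (((enorm z <= expR v * 1)%R%:R)%:E *
     ((0 <= v)%R%:R * (n%:R * expR (- (n%:R * v))))%:E))%E.
    by apply: eq_integral => z _; rewrite mulr1 -EFinM -mulrA.
  rewrite ge0_integralZr//; try iside.
  rewrite (integral_homogeneous_ball 1 md (@enormZ R d) (expR_gt0 v)) bE -!EFinM; congr EFin.
  rewrite -expRM_natl /n natrD.
  have -> : - ((d%:R + k%:R) * v) = - (d%:R * v) + - (k%:R * v) by ring.
  rewrite expRD (expRN (d%:R * v)).
  by field; rewrite !gt_eqF// expR_gt0.
rewrite ge0_integralZl//; try iside.
by rewrite integral_exp_tail// -EFinM ltry.
Qed.

(** By homogeneity [omega(|x|_1) = omega(n) (|x|_1 / n)^-k]. Each layer is the part of [D] in an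
    l1-ball of radius [e^v n], so its volume is at most both [V e^(n v)] and [m]. *)
Lemma integral_omega_le (d k : nat) (D : set 'rV[R]_(d + k)) (m V : R) :
  (0 < d)%N -> (0 < k)%N -> measurable D -> lam (d + k) D = m%:E -> 0 < m ->
  (\int[lam (d + k)]_x ((l1norm x <= (d + k)%:R)%R%:R)%:E = V%:E)%E -> 0 < V ->
  (\int[lam (d + k)]_x (omega d (d + k) (l1norm x) * (\1_D x)%:E) <=
   omega d (d + k) (d + k)%:R *
     ((d + k)%:R / d%:R * (m * (V / m) `^ (k%:R / (d + k)%:R)))%:E)%E.
Proof.
move=> d0 k0 mD Dm m0 VE V0.
have [n' n'E] : exists n', (d + k)%N = n'.+1 by exists (d + k).-1; rewrite prednK// addn_gt0 d0.
have n0 : 0 < (d + k)%:R :> R by rewrite ltr0n n'E.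
set om := omega d (d + k) (d + k)%:R.
have om0 : (0 <= om)%E by exact: omega_ge0.
move: n'E D mD Dm VE n0 @om om0; set n := (d + k)%N => n'E D mD Dm VE n0 om om0.
have ml := @measurable_l1norm R n; have mo := @measurable_omega R d n.
have oo0 s : (0 <= omega d n s :> \bar R)%E by exact: omega_ge0.
have mI : measurable_fun setT (\1_D : _ -> R) by exact: measurable_indic.
have I0 x : 0 <= \1_D x :> R by rewrite indicE.
have kk : 0 < k%:R :> R by rewrite ltr0n.
have dd : 0 < d%:R :> R by rewrite ltr0n.
pose F (x : 'rV[R]_n) (v : R) : \bar R :=
  ((l1norm x <= expR v * n%:R)%R%:R * (k%:R * expR (- (k%:R * v))) * \1_D x)%:E.
have mF : measurable_fun setT (fun p : 'rV[R]_n * R => F p.1 p.2) by rewrite /F; mfun.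
have F0 x v : (0 <= F x v)%E by rewrite /F; nonneg.
have step1 : (\int[lam n]_x (omega d n (l1norm x) * (\1_D x)%:E) =
    om * \int[lam n]_x \int[leb]_v F x v)%E.
  rewrite -ge0_integralZl//; [|exact: measurable_integralr|by nonneg].
  have mG : measurable_fun setT (fun x => om * \int[leb]_v F x v)%E.
    by apply: emeasurable_funM => //; exact: measurable_integralr.
  have mH : measurable_fun setT (fun x => omega d n (l1norm x) * (\1_D x)%:E)%E by mfun.
  have G0 x : (0 <= om * \int[leb]_v F x v)%E by nonneg.
  have H0 x : (0 <= omega d n (l1norm x) * (\1_D x)%:E)%E by nonneg.
  have HG x : x != 0 -> (omega d n (l1norm x) * (\1_D x)%:E = om * \int[leb]_v F x v)%E.
    move=> x0; have r0 : 0 < l1norm x / n%:R.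
      by rewrite divr_gt0// lt_neqAle eq_sym l1norm_eq0 x0 l1norm_ge0.
    rewrite -[X in omega _ _ X](@divfK _ n%:R) ?gt_eqF// omega_scale// -/om.
    rewrite -(layer_cake k0 r0) muleAC muleC; congr (_ * _)%E.
    rewrite -ge0_integralZr//; try iside.
    by apply: eq_integral => v _; rewrite /F -EFinM ler_pdivrMr.
  by apply: integral_rV_neq0 => //; rewrite n'E.
rewrite step1 lee_wpmul2l// (tonelli_curried (lam n) leb mF F0).
(* The two volume bounds meet at [v0], where [V e^(n v0) = m]: [f1] accounts for the l1-ball bound
   below [v0], and [f2] for the bound [m] above it. *)
pose v0 := ln (m / V) / n%:R.
have env0 : expR (n%:R * v0) = m / V.
  by rewrite /v0 mulrC divfK ?gt_eqF// lnK// posrE divr_gt0.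
pose f1 (v : R) := ((v <= v0)%R%:R * (d%:R * expR (d%:R * v)))%:E.
pose f2 (v : R) := ((v0 <= v)%R%:R * (k%:R * expR (- (k%:R * v))))%:E.
have mf1 : measurable_fun setT f1 by rewrite /f1; mfun.
have mf2 : measurable_fun setT f2 by rewrite /f2; mfun.
have f10 v : (0 <= f1 v)%E by rewrite /f1; nonneg.
have f20 v : (0 <= f2 v)%E by rewrite /f2; nonneg.
have Vd0 : 0 <= V * k%:R / d%:R by nonneg.
apply: (@le_trans _ _ (\int[leb]_v ((V * k%:R / d%:R)%:E * f1 v + m%:E * f2 v))%E).
  apply: ge0_le_integral => //.
  - by nonneg.
  - by apply: (measurable_integralr (lam n) (f := fun v x => F x v)); [rewrite /F; mfun|nonneg].
  - by apply: emeasurable_funD; mfun.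
  move=> v _.
  have J : (\int[lam n]_x F x v = (k%:R * expR (- (k%:R * v)))%:E *
      \int[lam n]_x ((l1norm x <= expR v * n%:R)%R%:R * \1_D x)%:E)%E.
    rewrite -ge0_integralZl//; try iside.
    by apply: eq_integral => x _; rewrite /F -EFinM; congr EFin; ring.
  rewrite J.
  have [vv|vv] := leP v v0.
    apply: (@le_trans _ _ ((k%:R * expR (- (k%:R * v)))%:E * (expR v ^+ n * V)%:E)%E).
      apply: lee_wpmul2l; first by nonneg.
      rewrite EFinM -VE -(integral_homogeneous_ball n%:R ml (@l1normZ R n) (expR_gt0 v)).
      apply: ge0_le_integral => //; try iside.
      by move=> x _; rewrite lee_fin ler_piMr ?indicE ?ler0n ?lern1 ?leq_b1.
    rewrite -[X in (X <= _)%E]adde0; apply: leeD; last by nonneg.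
    rewrite /f1 vv mul1r -!EFinM lee_fin -expRM_natl /n natrD.
    have -> : - (k%:R * v) = d%:R * v - (d%:R + k%:R) * v by ring.
    rewrite expRD expRN le_eqVlt; apply/orP; left; apply/eqP.
    by field; rewrite !gt_eqF// expR_gt0.
  apply: (@le_trans _ _ ((k%:R * expR (- (k%:R * v)))%:E * m%:E)%E).
    apply: lee_wpmul2l; first by nonneg.
    rewrite -Dm -[D in lam n D]setIT -integral_indic//.
    apply: ge0_le_integral => //; try iside.
    by move=> x _; rewrite lee_fin ler_piMl ?I0 ?lern1 ?leq_b1.
  rewrite -[X in (X <= _)%E]add0e; apply: leeD; first by nonneg.
  by rewrite /f2 (ltW vv) mul1r muleC.
rewrite ge0_integralD//; try iside.
rewrite !ge0_integralZl//; try iside.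
rewrite integral_exp_head// integral_exp_tail// -!EFinM -EFinD lee_fin.
have -> : (V / m) `^ (k%:R / n%:R) = expR (- (k%:R * v0)).
  rewrite /powR gt_eqF ?divr_gt0//; congr expR.
  rewrite /v0 -[V / m]invrK invf_div lnV ?posrE ?divr_gt0//.
  by field; rewrite gt_eqF.
(* By the choice of [v0] both pieces are multiples of [m e^(-k v0)], with factors [k/d] and 1; their
   sum is the constant [n/d]. *)
have E : V * expR (d%:R * v0) = m * expR (- (k%:R * v0)).
  have -> : d%:R * v0 = n%:R * v0 + - (k%:R * v0) by rewrite /n natrD; ring.
  by rewrite expRD env0; field; rewrite gt_eqF.
rewrite le_eqVlt; apply/orP; left; apply/eqP.
have -> : V * k%:R / d%:R * expR (d%:R * v0) = k%:R / d%:R * (V * expR (d%:R * v0)) by ring.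
rewrite E /n natrD; field; exact: lt0r_neq0.
Qed.

End OmegaEstimates.


(** * Pull-backs by matrices, via Gram-Schmidt *)

Section GramSchmidt.
Variable R : realType.
Local Notation leb := (@lebesgue_measure R).
Local Notation lam := (@lebesgue_rV R).

Lemma enorm_orthonormal (d n : nat) (Q : 'M[R]_(d, n)) (y : 'rV[R]_d) :
  Q *m Q^T = 1%:M -> enorm (y *m Q) = enorm y.
Proof.
move=> QQ; apply/eqP; rewrite -(@eqrXn2 _ 2) ?enorm_ge0//.
by rewrite -!enorm_dot trmx_mul mulmxA -[y *m Q *m _]mulmxA QQ mulmx1.
Qed.

Lemma enormD_sqr_le (n : nat) (x y : 'rV[R]_n) :
  enorm (x + y) ^+ 2 <= 2 * enorm x ^+ 2 + 2 * enorm y ^+ 2.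
Proof.
rewrite !enorm_sqr !mulr_sumr -big_split/=; apply: ler_sum => i _.
by rewrite mxE; have := sqr_ge0 (x ord0 i - y ord0 i); lra.
Qed.

Lemma cons_row_mul (d n : nat) (s : R) (y : 'rV[R]_d) (g : 'rV[R]_n) (G : 'M[R]_(d, n)) :
  cons_row s y *m (col_mx g G : 'M[R]_(d.+1, n)) = s *: g + y *m G.
Proof. by rewrite /cons_row (@mul_row_col R 1 1 d n) mul_scalar_mx. Qed.

Lemma indic_integral_pos (d : nat) (r : R) : 0 < r ->
  (0 < \int[lam d]_y ((enorm y <= r)%R%:R)%:E)%E.
Proof.
move=> r0; have := lebesgue_cball_gt0 d r0.
rewrite -[cball d r]setIT -integral_indic//; last exact: measurable_cball.
congr (_ < _)%E; apply: eq_integral => z _; rewrite indicE.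
by case: (boolP (enorm z <= r)) => zr; [rewrite mem_set|rewrite memNset//; exact/negP].
Qed.

(* A degenerate [G] makes the pull-back of Lebesgue measure infinite on every ball. *)
Lemma gram_schmidt_integral (d n : nat) (G : 'M[R]_(d, n)) :
  (exists (Q : 'M[R]_(d, n)) (c : R), [/\ Q *m Q^T = 1%:M, 0 < c &
     forall phi, measurable_fun setT phi -> (forall x, 0 <= phi x)%E ->
       (\int[lam d]_z phi (z *m G)%R = c%:E * \int[lam d]_z phi (z *m Q)%R)%E]) \/
  (forall r : R, 0 < r -> (\int[lam d]_z ((enorm (z *m G) <= r)%R%:R)%:E = +oo)%E).
Proof.
elim: d G => [|d IH] G.
  left; exists G, 1; split => //; first by apply/matrixP => -[].
  by move=> phi mphi phi0; rewrite mul1e.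
have [g [G' ->]] : exists (g : 'rV[R]_n) G', G = col_mx g G' :> 'M[R]_(1 + d, n).
  by exists (usubmx (G : 'M[R]_(1 + d, n))), (dsubmx (G : 'M[R]_(1 + d, n))); rewrite vsubmxK.
have split_int phi : measurable_fun setT phi -> (forall x : 'rV[R]_n, 0 <= phi x)%E ->
    forall (h : 'rV[R]_n) (H : 'M[R]_(d, n)),
    (\int[lam d.+1]_z phi (z *m (col_mx h H : 'M[R]_(d.+1, n)))%R =
     \int[leb]_s \int[lam d]_y phi (s *: h + y *m H)%R)%E.
  move=> mphi phi0 h H; rewrite integral_lebesgue_rVS//; last by mfun.
  by apply: eq_integral => s _; apply: eq_integral => y _; rewrite cons_row_mul.
have men := @measurable_enorm R n.
have [[Q [c [QQ c0 GQ]]]|Goo] := IH G'; last first.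
  right=> r r0.
  have mphi : measurable_fun setT (fun x : 'rV[R]_n => ((enorm x <= r)%R%:R)%:E : \bar R) by mfun.
  rewrite (split_int _ mphi); last by nonneg.
  (* For [|s| <= delta] the vector [s g] has norm at most [r/2], so the slice at [s] contains every
     [y] with [|y G'| <= r/2]. It is infinite for all [s] in an interval of positive length. *)
  pose delta := r / 2 / (enorm g + 1).
  have g1 : 0 < enorm g + 1 by rewrite ltr_wpDl ?enorm_ge0.
  have delta0 : 0 < delta by rewrite !divr_gt0.
  apply/eqP; rewrite eq_le leey/=.
  apply: (@le_trans _ _ (\int[leb]_s ((`|s| <= delta)%R%:R%:E * +oo)))%E.
    rewrite ge0_integralZr//; try iside.
    rewrite gt0_muley//.
    apply: (@lt_le_trans _ _ (leb `[- delta, delta]%classic)).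
      by rewrite lebesgue_measure_itv/= lte_fin gtrN// -EFinB lte_fin subr_gt0 gtrN.
    rewrite -[X in leb X]setIT -integral_indic//.
    apply: ge0_le_integral => //; try iside.
      by apply/measurable_EFinP; exact: measurable_indic.
    by move=> s _; rewrite indicE mem_setE in_itv/= ler_norml.
  apply: ge0_le_integral => //; try iside.
  move=> s _; have [sd|sd] := leP `|s| delta; last by rewrite mul0e; nonneg.
  rewrite mul1e -(Goo _ (divr_gt0 r0 (ltr0n R 2))).
  apply: ge0_le_integral => //; try iside.
  move=> y _; rewrite lee_fin.
  have [yr|//] := leP (enorm (y *m G')) (r / 2).
  rewrite (_ : (enorm _ <= r) = true)//.
  rewrite -(@ler_pXn2r _ 2)// ?nnegrE ?enorm_ge0 ?(ltW r0)//.
  apply: (le_trans (enormD_sqr_le _ _)).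
  have a1 : enorm (s *: g) ^+ 2 <= (r / 2) ^+ 2.
    rewrite ler_pXn2r ?nnegrE ?enorm_ge0 ?divr_ge0 ?(ltW r0)//.
    rewrite -(@ler_pXn2r _ 2)// ?nnegrE ?enorm_ge0 ?divr_ge0 ?(ltW r0)//.
    have -> : enorm (s *: g) ^+ 2 = (`|s| * enorm g) ^+ 2.
      rewrite exprMn real_normK ?num_real// !enorm_sqr mulr_sumr.
      by apply: eq_bigr => i _; rewrite mxE exprMn.
    rewrite ler_pXn2r ?nnegrE ?mulr_ge0 ?enorm_ge0 ?divr_ge0 ?(ltW r0)//.
    have : `|s| * (enorm g + 1) <= r / 2 by rewrite -ler_pdivlMr.
    by have := normr_ge0 s; nra.
  have a2 : enorm (y *m G') ^+ 2 <= (r / 2) ^+ 2.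
    by rewrite ler_pXn2r ?nnegrE ?enorm_ge0 ?divr_ge0 ?(ltW r0).
  by move: a1 a2; rewrite (_ : (r / 2) ^+ 2 = r ^+ 2 / 4); [lra|field].
(* [p] is the component of the new row [g] orthogonal to the rows of [Q]; the remaining part [s w]
   is absorbed by translating [y]. *)
pose w := g *m Q^T; pose p := g - w *m Q.
have pQ : p *m Q^T = 0 by rewrite /p /w mulmxBl -!mulmxA QQ mulmx1 subrr.
have redux phi : measurable_fun setT phi -> (forall x : 'rV[R]_n, 0 <= phi x)%E ->
    (\int[leb]_s \int[lam d]_y phi (s *: g + y *m G')%R =
     c%:E * \int[leb]_s \int[lam d]_y phi (s *: p + y *m Q)%R)%E.
  move=> mphi phi0.
  rewrite -ge0_integralZl//; try iside.
  apply: eq_integral => s _.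
  have mps : measurable_fun setT (fun x => phi (s *: g + x)) by mfun.
  rewrite (GQ _ mps)//; congr (_ * _)%E.
  have mpt : measurable_fun setT (fun y => phi (s *: p + y *m Q)) by mfun.
  rewrite -(integral_translate_rV (s *: w) mpt)//.
  apply: eq_integral => y _; congr phi.
  rewrite /p mulmxDl -scalemxAl scalerBr -addrA; congr (_ + _).
  by rewrite addrC addrK.
(* If [g] lies in the span of the rows of [Q], the inner integral is a positive constant in [s] and
   the integral over the line diverges. *)
have [p0|p0] := eqVneq p 0.
  right=> r r0.
  have mphi : measurable_fun setT (fun x : 'rV[R]_n => ((enorm x <= r)%R%:R)%:E : \bar R) by mfun.
  rewrite (split_int _ mphi); last by nonneg.
  rewrite (redux _ mphi); last by nonneg.
  have -> : (\int[leb]_s \int[lam d]_y ((enorm (s *: p + y *m Q) <= r)%R%:R)%:E =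
    \int[leb]_s \int[lam d]_y ((enorm y <= r)%R%:R)%:E)%E.
    apply: eq_integral => s _; apply: eq_integral => y _.
    by rewrite p0 scaler0 add0r enorm_orthonormal.
  have lebT : leb [set: R] = +oo%E.
    by have := lebesgue_measure_itv (`]-oo, +oo[ : interval R); rewrite set_itvNyy.
  have C0 := indic_integral_pos d r0.
  set C := (\int[lam d]_y _)%E in C0 *.
  have -> : (\int[leb]__ C = C * +oo)%E.
    by apply: (etrans (integral_cst leb measurableT C)); congr (_ * _)%E.
  by rewrite !gt0_muley.
left; set e := enorm p.
have e0 : 0 < e by rewrite lt_neqAle eq_sym enorm_eq0 p0 enorm_ge0.
pose q := e^-1 *: p.
exists (col_mx q Q : 'M[R]_(d.+1, n)), (c / e); split; last 2 first.
- by rewrite divr_gt0.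
- move=> phi mphi phi0.
  rewrite (split_int _ mphi phi0 g G') (redux _ mphi phi0) EFinM -muleA; congr (_ * _)%E.
  pose F s := (\int[lam d]_y phi (s *: q + y *m Q)%R)%E.
  have mF : measurable_fun setT F by rewrite /F; iside.
  have F0 s : (0 <= F s)%E by rewrite /F; nonneg.
  transitivity (\int[leb]_s F (e * s + 0)%R)%E.
    apply: eq_integral => s _; rewrite /F; apply: eq_integral => y _.
    by rewrite addr0 /q scalerA mulrAC divff ?mul1r// gt_eqF.
  apply: (etrans (integral_lebesgue_affine 0 e0 mF F0)).
  rewrite ge0_integralZl//; last by rewrite lee_fin invr_ge0 ltW.
  by congr (_ * _)%E; exact/esym/(split_int _ mphi phi0 q Q).
have qq : q *m q^T = 1%:M.
  apply/matrixP => i j; rewrite !ord1 enorm_dot mxE eqxx /q enormZ ?invr_ge0 ?ltW//.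
  by rewrite mulVf ?expr1n// gt_eqF.
have qQ : q *m Q^T = 0 by rewrite /q -scalemxAl pQ scaler0.
have Qq : Q *m q^T = 0 by rewrite -[LHS]trmxK trmx_mul trmxK qQ trmx0.
rewrite (@tr_col_mx R 1 d n) (@mul_col_row R 1 d n 1 d) qq qQ Qq QQ.
by rewrite -(@scalar_mx_block R 1 d).
Qed.

(** Gram-Schmidt puts the same factor [c] on both sides, and a central section of the unit ball has
    volume exactly [b]. Since [0 < M], the right-hand side is indeed [+oo], not [0 * +oo], for
    degenerate [G]. *)
Lemma section_bound (d n : nat) (phi : 'rV[R]_n -> \bar R) (M b : R) (G : 'M[R]_(d, n)) :
  measurable_fun setT phi -> (forall x, 0 <= phi x)%E -> 0 < M ->
  (\int[lam d]_y ((enorm y <= 1)%R%:R)%:E = b%:E)%E ->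
  (forall Q : 'M[R]_(d, n), Q *m Q^T = 1%:M -> (\int[lam d]_z phi (z *m Q)%R <= M%:E)%E) ->
  (\int[lam d]_z phi (z *m G)%R <=
   (M / b)%:E * \int[lam d]_z ((enorm (z *m G) <= 1)%R%:R)%:E)%E.
Proof.
move=> mphi phi0 M0 bE HM.
have b0 : 0 < b by rewrite -lte_fin -bE indic_integral_pos.
have men := @measurable_enorm R n.
have [[Q [c [QQ c0 GQ]]]|Goo] := gram_schmidt_integral G; last first.
  by rewrite (Goo _ ltr01) gt0_muley ?leey// lte_fin divr_gt0.
have mchi : measurable_fun setT (fun x : 'rV[R]_n => ((enorm x <= 1)%R%:R)%:E : \bar R) by mfun.
rewrite (GQ _ mphi)// (GQ _ mchi); last by nonneg.
have -> : (\int[lam d]_z ((enorm (z *m Q) <= 1)%R%:R)%:E = b%:E :> \bar R)%E.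
  by rewrite -bE; apply: eq_integral => y _; rewrite enorm_orthonormal.
have -> : ((M / b)%:E * (c%:E * b%:E) = c%:E * M%:E)%E.
  by rewrite -!EFinM; congr EFin; field; rewrite gt_eqF.
by apply: lee_wpmul2l; [rewrite lee_fin ltW|exact: HM].
Qed.

End GramSchmidt.


(** * Open sets and continuous densities are measurable *)

Section BorelRowVectors.
Variables (R : realType) (n : nat).

(** An open set is the countable union of the closed cubes with rational centre and half-side
    [1/(m + 1)] that it contains. *)
Lemma open_measurable_rV (A : set 'rV[R]_n) : open A -> measurable A.
Proof.
move=> oA.
pose B (q : 'rV[rat]_n) (m : nat) : set 'rV[R]_n :=
  [set x | forall i, `|x ord0 i - ratr (q ord0 i)| <= m.+1%:R^-1].
have mB q m : measurable (B q m).
  pose f (x : 'rV[R]_n) := x - \row_i ratr (q ord0 i).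
  have mf : measurable_fun setT f by rewrite /f; mfun.
  rewrite (_ : B q m = f @^-1` box (fun=> m.+1%:R^-1)).
    by rewrite -[X in measurable X]setTI; apply: mf => //; exact: measurable_box.
  by apply/seteqP; split => x /= xB i; have := xB i; rewrite !mxE.
pose F (t : 'rV[rat]_n * nat) : set 'rV[R]_n :=
  if `[< B t.1 t.2 `<=` A >] then B t.1 t.2 else set0.
have -> : A = \bigcup_t F t.
  apply/seteqP; split => x; last first.
    by move=> [t _]; rewrite /F; case: ifPn => [/asboolP BA /BA|].
  move=> Ax; have /nbhs_ballP[e /= e0 xe] : nbhs x A by exact: open_nbhs_nbhs.
  (* A cube of half-side [1/(m + 1)] containing [x] stays within [2/(m + 1) < e] of [x]. *)
  pose m := Num.truncn (2 / e).
  have m0 : 0 < m.+1%:R^-1 :> R by rewrite invr_gt0 ltr0n.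
  have me : 2 * m.+1%:R^-1 < e.
    rewrite ltr_pdivrMr ?ltr0n// mulrC -ltr_pdivrMr//.
    exact: truncnS_gt.
  have /choice[q qx] : forall i, exists q : rat, `|x ord0 i - ratr q| <= m.+1%:R^-1.
    move=> i.
    have /rat_in_itvoo[q] : x ord0 i - m.+1%:R^-1 < x ord0 i + m.+1%:R^-1.
      by rewrite ltrBlDr -addrA ltrDl addr_gt0.
    rewrite in_itv/=; move: (m.+1%:R^-1) => delta /andP[q1 q2].
    by exists q; rewrite ler_norml; apply/andP; split; lra.
  exists (\row_i q i, m) => //; rewrite /F /= ifT.
    by move=> i; rewrite mxE.
  apply/asboolP => y yB; apply: xe; split => // i j; rewrite ord1.
  have := yB j; rewrite mxE => yq; apply: le_lt_trans me.
  rewrite (_ : x ord0 j - y ord0 j = (x ord0 j - ratr (q j)) - (y ord0 j - ratr (q j))); last by ring.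
  by apply: le_trans (ler_normB _ _) _; rewrite mulr2n mulrDl !mul1r lerD.
apply: countable_bigcupT_measurable => // t.
by rewrite /F; case: ifPn.
Qed.

Lemma closed_measurable_rV (A : set 'rV[R]_n) : closed A -> measurable A.
Proof. by move=> /closed_openC/open_measurable_rV/measurableC; rewrite setCK. Qed.

Lemma continuous_restrict_measurable (L : set 'rV[R]_n) (g : 'rV[R]_n -> R) :
  closed L -> {within L, continuous g} ->
  measurable_fun setT (fun x => (\1_L x * g x)%:E).
Proof.
move=> cL /continuousP cg; apply/measurable_EFinP.
have mL := closed_measurable_rV cL.
have mg : measurable_fun L g.
  apply: (measurability _ (RGenOpens.measurableE R)).
  move=> _ [_ [a [b ->] <-]].
  have /cg/open_subspaceP[V oV VD] : open (`]a, b[%classic : set R) by exact: interval_open.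
  by rewrite setIC -VD; apply: measurableI => //; exact: open_measurable_rV.
rewrite (_ : (fun x => _) = g \_ L); first exact/(measurable_restrictT g mL).
apply/funext => x; rewrite patchE indicE.
by case: (x \in L); rewrite ?mul1r ?mul0r.
Qed.

End BorelRowVectors.


(** * Unconditional bodies between a box and a weighted l1-ball *)

Section Lozanovskii.
Variables (R : realType) (n : nat) (L : set 'rV[R]_n).
Hypotheses (Lbody : convex_body L) (Lunc : unconditional L).

Let Lcompact : compact L. Proof. by case: Lbody. Qed.
Let Lconvex : convex_set_rV L. Proof. by case: Lbody => _ []. Qed.

Lemma convex_body_closed : closed L.
Proof. by apply: compact_closed Lcompact; exact: norm_hausdorff. Qed.

Let ball_entries (x : 'rV[R]_n) : nbhs x L ->
  exists2 e : R, 0 < e & forall y : 'rV[R]_n, (forall i, `|x ord0 i - y ord0 i| < e) -> L y.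
Proof.
move=> /nbhs_ballP[d /= d0 xd]; exists d => // y xy.
by apply: xd; split => // i j; rewrite ord1; exact: xy.
Qed.

Lemma convex_body_interior :
  exists2 e : R, 0 < e & forall y : 'rV[R]_n, (forall i, `|y ord0 i| < e) -> L y.
Proof.
have [_ [_ L0]] := Lbody; have [e e0 eL] := ball_entries L0.
by exists e => // y ye; apply: eL => i; rewrite mxE sub0r normrN.
Qed.

Let L0 : L 0.
Proof. by have [e e0] := convex_body_interior; apply=> i; rewrite mxE normr0. Qed.

Let gauge_set (x : 'rV[R]_n) := [set a : R | 0 <= a /\ [set a *: y | y in L] x].

Let gauge_le1 x : L x -> gauge L x <= 1.
Proof.
move=> Lx; apply: ge_inf; first by exists 0 => a [].
by split => //; exists x => //; rewrite scale1r.
Qed.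

Let gauge_set_nonempty x : gauge_set x !=set0.
Proof.
have [e e0 eL] := convex_body_interior.
have N0 : 0 < enorm x + 1 by rewrite ltr_wpDl ?enorm_ge0.
have a0 : 0 < (enorm x + 1) / e by rewrite divr_gt0.
exists ((enorm x + 1) / e); split; first exact: ltW.
exists (((enorm x + 1) / e)^-1 *: x); last by rewrite scalerA divff ?scale1r// gt_eqF.
apply: eL => i; rewrite mxE normrM gtr0_norm ?invr_gt0// ltr_pdivrMl// divfK ?gt_eqF//.
by apply: le_lt_trans (enorm_entry x i) _; rewrite ltrDl.
Qed.

(** With [gauge_le1] this turns invariance of the gauge under sign changes into invariance of
    membership. If [x] were outside the closed set [L], so would be [t x] for some [t < 1]; but a
    multiple [b < 1/t] with [x] in [bL] puts [t x] on a segment from 0 to a point of [L]. *)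
Let le1_gauge x : gauge L x <= 1 -> L x.
Proof.
move=> gx; apply: contrapT => nLx.
have /nbhs_ballP[e /= e0 xe] : nbhs x (~` L).
  by apply: open_nbhs_nbhs; split => //; exact/closed_openC/convex_body_closed.
have N0 : 0 <= enorm x by exact: enorm_ge0.
(* [D] exceeds both [|x|] and [e], so [t = 1 - e/D] lies in []0, 1[] and [t x] is within [e] of
   [x]. *)
pose D := enorm x + 1 + e; have D0 : 0 < D by rewrite /D; lra.
pose t := 1 - e / D.
have eD : 0 < e / D < 1.
  by rewrite divr_gt0//= ltr_pdivrMr// mul1r /D; lra.
have t01 : 0 < t < 1 by rewrite /t; lra.
have [t0 t1] := andP t01.
apply: (xe (t *: x)).
  split => // i j; rewrite ord1 mxE /ball/= /t.
  have -> : x ord0 j - (1 - e / D) * x ord0 j = e / D * x ord0 j by ring.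
  rewrite normrM gtr0_norm ?divr_gt0// mulrAC ltr_pdivrMr// ltr_pM2l//.
  by apply: le_lt_trans (enorm_entry x j) _; rewrite /D; lra.
have : gauge L x < t^-1 by apply: le_lt_trans gx _; rewrite invf_gt1.
move=> /(inf_lt (gauge_set_nonempty x))[b [b0 [y Ly <-]] bt].
have tb : 0 <= t * b <= 1.
  by rewrite mulr_ge0 ?(ltW t0)//= -ler_pdivlMl// mulr1 ltW.
have := Lconvex Ly L0 tb.
by rewrite scaler0 addr0 scalerA.
Qed.

Let flip x (d : 'I_n -> R) : (forall i, d i = 1 \/ d i = -1) -> L x ->
  L (\row_i (d i * x ord0 i)).
Proof. by move=> d1 Lx; apply: le1_gauge; rewrite Lunc//; exact: gauge_le1. Qed.

(* Shrinking one coordinate is a convex combination of the point and its reflection. *)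
Lemma unconditional_shrink x (t : 'I_n -> R) : (forall i, `|t i| <= 1) -> L x ->
  L (\row_i (t i * x ord0 i)).
Proof.
move=> t1 Lx.
suff H m : (m <= n)%N -> L (\row_i ((if (i < m)%N then t i else 1) * x ord0 i)).
  have := H n (leqnn n); congr L; apply/rowP => i.
  by rewrite !mxE ltn_ord.
elim: m => [_|m IH mn].
  by rewrite (_ : \row_i _ = x)//; apply/rowP => i; rewrite mxE mul1r.
have Ly := IH (ltnW mn); set y := (\row_i _) in Ly.
pose i0 := Ordinal mn.
have Ly' := @flip y (fun i => if i == i0 then -1 else 1) _ Ly.
have {}Ly' : L (\row_i ((if i == i0 then -1 else 1) * y ord0 i)).
  by apply: Ly' => i; case: ifP => _; [right|left].
(* Weights [(1 + t)/2] on the point and [(1 - t)/2] on its reflection multiply the chosen coordinate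
   by [t] and fix the others. *)
have tt : 0 <= (1 + t i0) / 2 <= 1.
  by have := t1 i0; rewrite ler_norml => /andP[? ?]; apply/andP; split; lra.
have := Lconvex Ly Ly' tt; congr L; apply/rowP => i; rewrite !mxE.
have [->|ii] := eqVneq i i0; first by rewrite /= ltnn ltnSn; field.
have -> : (i < m.+1)%N = (i < m)%N.
  rewrite ltnS leq_eqVlt; case: eqP => //= im.
  by move/eqP: ii => []; apply/val_inj.
by rewrite mul1r -mulrDl addrC subrK mul1r.
Qed.

Lemma unconditional_box x (a : 'I_n -> R) : (forall i, 0 < a i) ->
  L (\row_i a i) -> box a x -> L x.
Proof.
move=> a0 La xa.
have := @unconditional_shrink _ (fun i => x ord0 i / a i) _ La.
rewrite (_ : (\row_i (_ * _)) = x).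
  by apply=> i; rewrite normrM normfV (gtr0_norm (a0 i)) ler_pdivrMr// mul1r; exact: xa.
by apply/rowP => i; rewrite !mxE divfK// gt_eqF.
Qed.

End Lozanovskii.

(** Stands in for differentiating the product at a maximizer. The condition [-1 <= u i] keeps every
    factor nonnegative, so that the inequalities can be multiplied. *)
Lemma prod_first_order (R : realType) (n : nat) (u : 'I_n -> R) : (forall i, -1 <= u i) ->
  exists2 C : R, 0 <= C & forall e, 0 <= e <= 1 ->
    1 + e * (\sum_i u i) - C * e ^+ 2 <= \prod_i (1 + e * u i).
Proof.
elim: n u => [|n IH] u u1.
  by exists 0 => // e _; rewrite !big_ord0; lra.
have [C C0 HC] := IH (fun i => u (lift ord0 i)) (fun i => u1 _).
set S := \sum_(i < n) _ in HC; set v := u ord0.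
exists (`|S * v| + C * (1 + `|v|)); first by rewrite addr_ge0// mulr_ge0// addr_ge0.
move=> e e01; have [e0 e1] := andP e01.
rewrite !big_ord_recl -/S -/v.
have v1 : 0 <= 1 + e * v by have := u1 ord0; rewrite -/v; nra.
apply: le_trans (ler_wpM2l v1 (HC e e01)).
have Sv : - `|S * v| <= S * v by have := lerNnormlW (lexx `|S * v|); lra.
have vv : v <= `|v| by exact: ler_norm.
have nv : 0 <= `|v| by [].
have e2 : 0 <= e ^+ 2 by exact: sqr_ge0.
have p1 : - `|S * v| * e ^+ 2 <= S * v * e ^+ 2 by rewrite ler_wpM2r.
have ev : e * v <= `|v| by apply: le_trans (ler_wpM2l e0 vv) _; rewrite ler_piMl.
have p2 : C * e ^+ 2 * (e * v) <= C * e ^+ 2 * `|v| by rewrite ler_wpM2l// mulr_ge0.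
nra.
Qed.

(** Moving from the maximizer towards [|x|] by a fraction [t] multiplies the product of coordinates
    by [prod (1 + t u_i)] with [u_i = |x_i|/a_i - 1]. This cannot exceed 1, so the first-order term
    [sum u_i] is at most 0. *)
Lemma unconditional_lozanovskii (R : realType) (n : nat) (L : set 'rV[R]_n) :
  convex_body L -> unconditional L ->
  exists a : 'I_n -> R, [/\ forall i, 0 < a i, box a `<=` L &
    forall x, L x -> \sum_i `|x ord0 i| / a i <= n%:R].
Proof.
move=> Lb Lu.
have Labs x : L x -> L (\row_i `|x ord0 i|).
  move=> Lx; have := unconditional_shrink Lb Lu (t := fun i => if 0 <= x ord0 i then 1 else -1) _ Lx.
  rewrite (_ : (\row_i (_ * _)) = \row_i `|x ord0 i|).
    by apply=> i; case: ifP; rewrite ?normrN normr1.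
  apply/rowP => i; rewrite !mxE; case: (leP 0 (x ord0 i)) => xi; first by rewrite mul1r ger0_norm.
  by rewrite mulN1r ltr0_norm.
pose f (x : 'rV[R]_n) := \prod_i `|x ord0 i|.
have cf : continuous f.
  rewrite /f; elim: (index_enum _) => [|i s IH].
    rewrite (_ : (fun x => _) = fun=> 1); first exact: cst_continuous.
    by apply/funext => x; rewrite big_nil.
  rewrite (_ : (fun x => _) = (fun x : 'rV[R]_n => `|x ord0 i| * \prod_(j <- s) `|x ord0 j|));
    last by apply/funext => x; rewrite big_cons.
  move=> x; apply: (@continuousM _ _ (fun x : 'rV[R]_n => `|x ord0 i|)
    (fun x : 'rV[R]_n => \prod_(j <- s) `|x ord0 j|)); last exact: IH.
  apply: (@continuous_comp _ _ _ (fun x : 'rV[R]_n => x ord0 i) (fun r : R => `|r|)).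
    exact: coord_continuous.
  exact: norm_continuous.
have [e e0 eL] := convex_body_interior Lb.
(* A point of [L] with positive coordinates makes the maximal product positive, hence every [a i]
   nonzero. *)
have Le : L (const_mx (e / 2)).
  by apply: eL => i; rewrite mxE gtr0_norm ?divr_gt0// ltr_pdivrMr// mulr_natr mulr2n ltrDl.
have Lc : compact L by case: Lb.
have [b Lb' bmax] := @EVT_max_rV R n f L (ex_intro _ _ Le) Lc (continuous_subspaceT cf).
rewrite inE in Lb'.
pose a i := `|b ord0 i|.
have fb0 : 0 < f b.
  apply: lt_le_trans (bmax _ (mem_set Le)).
  by rewrite /f prodr_gt0// => i _; rewrite mxE normr_gt0 gt_eqF// divr_gt0.
have a0 i : 0 < a i.
  rewrite normr_gt0; apply/eqP => bi; move: fb0; rewrite /f (bigD1 i)//= bi normr0 mul0r.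
  by rewrite ltxx.
exists a; split => //.
  by move=> x; apply: (unconditional_box Lb Lu a0); exact: Labs.
move=> x Lx; pose u i := `|x ord0 i| / a i - 1.
suff : \sum_i u i <= 0.
  by rewrite /u sumrB subr_le0 sumr_const card_ord.
have u1 i : -1 <= u i by rewrite lerBrDr addNr divr_ge0// ltW.
have [C C0 HC] := prod_first_order u1.
rewrite leNgt; apply/negP => S0; set S := \sum_i u i in S0 HC.
(* This [t] is small enough that [t S - C t^2 > 0], which contradicts maximality; [C + 1] guards
   against [C = 0]. *)
pose t := Num.min 1 (S / (2 * (C + 1))).
have C1 : 0 < 2 * (C + 1) by lra.
have t0 : 0 < t by rewrite lt_min ltr01 divr_gt0.
have t1 : t <= 1 by rewrite ge_min lexx.
have tS : t * (2 * (C + 1)) <= S by rewrite -ler_pdivlMr// ge_min lexx orbT.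
have Ly : L (t *: (\row_i `|x ord0 i|) + (1 - t) *: (\row_i a i)).
  have [_ [cvx _]] := Lb; apply: cvx; rewrite ?(ltW t0)//; exact: Labs.
have := bmax _ (mem_set Ly).
rewrite (_ : f _ = f b * \prod_i (1 + t * u i)); last first.
  rewrite /f -big_split/=; apply: eq_bigr => i _; rewrite !mxE -/(a i) /u.
  rewrite ger0_norm; first by field; rewrite gt_eqF.
  by rewrite addr_ge0// mulr_ge0// ?subr_ge0 ?(ltW t0)// ltW.
rewrite ger_pMr// => H.
have tt : 0 <= t <= 1 by rewrite (ltW t0).
have := le_trans (HC t tt) H.
nra.
Qed.


(** * Volume constants and the estimate for unconditional bodies *)

Section UnconditionalBodies.
Variable R : realType.
Local Notation leb := (@lebesgue_measure R).
Local Notation lam := (@lebesgue_rV R).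

Lemma vol_eball_real (d : nat) : exists2 b : R, 0 < b &
  vol (@eball R d) = b%:E /\ (\int[lam d]_y ((enorm y <= 1)%R%:R)%:E = b%:E)%E.
Proof.
have b1 := lebesgue_cball_lty d (1 : R); have b0 := lebesgue_cball_gt0 d (@ltr01 R).
have E : (\int[lam d]_y ((enorm y <= 1)%R%:R)%:E = lam d (cball d 1))%E.
  rewrite -[cball d 1]setIT -integral_indic//; last exact: measurable_cball.
  apply: eq_integral => z _; rewrite indicE.
  by case: (boolP (enorm z <= 1)) => zr; [rewrite mem_set|rewrite memNset//; exact/negP].
rewrite E vol_eball; move: b0 b1; case: (lam d (cball d 1)) => [b| |]//.
by rewrite lte_fin => b0 _; exists b.
Qed.

(* Chernoff: [l1norm x <= n] implies [1 <= \prod_i expR (1 - `|x_i|)]. *)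
Lemma integral_l1ball (n : nat) : exists V : R,
  [/\ 0 < V, V <= (2 * expR 1) ^+ n &
    (\int[lam n]_x ((l1norm x <= n%:R)%R%:R)%:E = V%:E)%E].
Proof.
have ml := @measurable_l1norm R n.
have up : (\int[lam n]_x ((l1norm x <= n%:R)%R%:R)%:E <= ((2 * expR 1) ^+ n)%:E :> \bar R)%E.
  pose rho (_ : 'I_n) (x : R) := expR 1 * expR (- `|x|).
  have mrho i : measurable_fun setT (rho i) by rewrite /rho; mfun.
  have rho0 i x : 0 <= rho i x by rewrite /rho; nonneg.
  apply: (@le_trans _ _ (\int[lam n]_x (\prod_i rho i (x ord0 i))%:E)%E).
    apply: ge0_le_integral => //; try iside.
    move=> x _; rewrite lee_fin.
    have [xn|_] := leP (l1norm x) n%:R; last by nonneg.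
    rewrite /rho big_split/= prodr_const card_ord -expR_sum sumrN -/(l1norm x).
    rewrite -expRM_natl mulr1 -expRD -[X in X <= _](@expR0 R) ler_expR subr_ge0.
    by [].
  rewrite (integral_prod_coord mrho rho0).
  have -> : ((2 * expR 1) ^+ n)%:E = (\prod_(i < n) (2 * expR 1)%:E)%E :> \bar R.
    by rewrite prodEFin prodr_const card_ord.
  suff H (i : 'I_n) : (\int[leb]_x (rho i x)%:E <= (2 * expR 1)%:E)%E.
    (* Multiplying inequalities needs nonnegative left-hand sides, so the sign is carried through
       the product. *)
    pose le0 (x y : \bar R) := (0 <= x)%E && (x <= y)%E.
    suff /andP[] : le0 (\prod_(i < n) \int[leb]_x (rho i x)%:E)%E
      (\prod_(i < n) (2 * expR 1)%:E)%E by [].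
    apply: (big_ind2 le0); rewrite /le0.
    - by rewrite lexx lee01.
    - move=> x1 x2 y1 y2 /andP[? ?] /andP[? ?]; rewrite mule_ge0//=; exact: lee_pmul.
    - by move=> i _; rewrite H andbT; nonneg.
  pose f1 (y : R) := ((0 <= y)%R%:R * (1 * expR (- (1 * y))))%:E.
  pose f2 (y : R) := ((y <= 0)%R%:R * (1 * expR (1 * y)))%:E.
  have mf1 : measurable_fun setT f1 by rewrite /f1; mfun.
  have mf2 : measurable_fun setT f2 by rewrite /f2; mfun.
  have f10 y : (0 <= f1 y)%E by rewrite /f1; nonneg.
  have f20 y : (0 <= f2 y)%E by rewrite /f2; nonneg.
  apply: (@le_trans _ _ (\int[leb]_y ((expR 1)%:E * (f1 y + f2 y)))%E).
    apply: ge0_le_integral => //; try iside.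
      by apply: emeasurable_funM => //; exact: emeasurable_funD.
    move=> y _; rewrite /rho EFinM; apply: lee_wpmul2l; first by nonneg.
    rewrite /f1 /f2 -EFinD lee_fin !mul1r.
    have [y0|y0] := leP 0 y.
      by rewrite ger0_norm// mul1r lerDl; nonneg.
    by rewrite ltr0_norm// opprK (ltW y0) mul1r mul0r add0r.
  rewrite ge0_integralZl//; last 2 first.
  - exact: emeasurable_funD.
  - by move=> y _; rewrite adde_ge0.
  rewrite ge0_integralD//.
  rewrite integral_exp_tail// integral_exp_head// mulr0 oppr0 expR0 -EFinD -EFinM lee_fin.
  by rewrite mulrC.
have lo : (0 < \int[lam n]_x ((l1norm x <= n%:R)%R%:R)%:E :> \bar R)%E.
  apply: (@lt_le_trans _ _ (lam n (box (fun=> 1)))).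
    by rewrite lebesgue_box// lte_fin prodr_gt0// => i _; rewrite mulr1.
  rewrite -[X in lam n X]setIT -integral_indic//; last exact: measurable_box.
  apply: ge0_le_integral => //; try iside.
    by apply/measurable_EFinP; apply: measurable_indic; exact: measurable_box.
  move=> x _; rewrite lee_fin indicE.
  case: (boolP (x \in box (fun=> 1))) => [|_]; last by nonneg.
  rewrite inE => xb; rewrite (_ : (l1norm x <= n%:R) = true)//.
  apply: (@le_trans _ _ (\sum_(i < n) 1)); last by rewrite sumr_const card_ord.
  by apply: ler_sum => i _; exact: xb.
move: up lo; case: (integral _ _ _) => [V| |]//.
by rewrite lee_fin lte_fin => V1 V0; exists V.
Qed.

(** Produces both [e^k], as [(e^n)^(k/n)], and the numerator of [c_{n,k}], as [B^(1 - k/n)]. *)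
Lemma powR_volume_identity (d k : nat) (B v : R) : (0 < d)%N -> 0 < B -> 0 < v ->
  B * (expR 1 ^+ (d + k) * v / B) `^ (k%:R / (d + k)%:R) =
  expR k%:R * B `^ (d%:R / (d + k)%:R) * v `^ (k%:R / (d + k)%:R).
Proof.
move=> d0 B0 v0.
have n0 : 0 < d%:R + k%:R :> R by rewrite ltr_pwDl// ltr0n.
have e0 : 0 < expR 1 ^+ (d + k) :> R by rewrite exprn_gt0// expR_gt0.
rewrite /powR !gt_eqF ?divr_gt0 ?mulr_gt0//.
rewrite -{1}[B]lnK ?posrE// -!expRD; congr expR.
rewrite lnM ?posrE ?mulr_gt0 ?invr_gt0// lnM ?posrE// lnV ?posrE//.
rewrite -expRM_natl mulr1 expRK natrD.
by field; rewrite gt_eqF.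
Qed.

Lemma mu_of_le_sections (d k : nat) (L : set 'rV[R]_(d + k)) (g : 'rV[R]_(d + k) -> R)
    (M b B v : R) :
  (0 < d)%N -> (0 < k)%N -> convex_body L -> unconditional L ->
  {within L, continuous g} -> (forall x, L x -> 0 <= g x) ->
  vol (@eball R d) = b%:E -> vol (@eball R (d + k)) = B%:E -> vol L = v%:E ->
  0 < M -> (max_section d g L <= M%:E)%E ->
  (mu_of g L <= (expR k%:R * ((d + k)%:R / d%:R) * (B `^ (d%:R / (d + k)%:R) / b)
     * v `^ (k%:R / (d + k)%:R) * M)%:E)%E.
Proof.
move=> d0 k0 Lb Lu cg g0 bE BE vE M0 maxM.
have [a [a0 aL Lo]] := unconditional_lozanovskii Lb Lu.
have cL := convex_body_closed Lb.
have mL := closed_measurable_rV cL.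
set n := (d + k)%N in L g Lb Lu cg g0 BE vE maxM a a0 aL Lo cL mL *.
pose phi (x : 'rV[R]_n) : \bar R := (\1_L x * g x)%:E.
have mphi : measurable_fun setT phi by exact: continuous_restrict_measurable.
have phi0 x : (0 <= phi x)%E.
  rewrite /phi lee_fin indicE; case: (boolP (x \in L)) => [|_]; last by rewrite mul0r.
  by rewrite inE mul1r; exact: g0.
have nd : 0 < n%:R :> R by rewrite ltr0n addn_gt0 d0.
have dd : 0 < d%:R :> R by rewrite ltr0n.
have [b' b0 [bE' bI]] := vol_eball_real d.
have bb : b' = b by move: bE'; rewrite bE => -[].
subst b'.
have [B' B0 [BE' BI]] := vol_eball_real n.
have BB : B' = B by move: BE'; rewrite BE => -[].
subst B'.
pose A := \prod_i a i.
have A0 : 0 < A by rewrite prodr_gt0.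
have vA : 2 ^+ n * A <= v.
  rewrite -lee_fin -vE volE//.
  rewrite (_ : (2 ^+ n * A)%:E = lam n (box a)).
    by apply: le_measure; rewrite ?inE//; exact: measurable_box.
  rewrite lebesgue_box; last by move=> i; exact: ltW.
  by rewrite big_split/= prodr_const card_ord.
have v0 : 0 < v by apply: lt_le_trans vA; rewrite mulr_gt0// exprn_gt0.
pose D (x : 'rV[R]_n) : 'rV[R]_n := \row_i (a i * x ord0 i + 0).
have mD : measurable_fun setT D by rewrite /D; mfun.
have men := @measurable_enorm R n; have ml := @measurable_l1norm R n.
have mo := @measurable_omega R d n.
have o0 s : (0 <= omega d n s :> \bar R)%E by exact: omega_ge0.
have scaled (f : 'rV[R]_n -> \bar R) : measurable_fun setT f -> (forall x, 0 <= f x)%E ->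
    (\int[lam n]_x f (D x) = (A^-1)%:E * \int[lam n]_x f x)%E.
  by move=> mf f0; exact: (integral_affine_rV (fun=> 0) a0 mf f0).
pose phi' x := phi (D x).
pose chi (x : 'rV[R]_n) : \bar R := ((enorm x <= 1)%R%:R)%:E.
pose chi' x := chi (D x).
have mchi : measurable_fun setT chi by rewrite /chi; mfun.
have mphi' : measurable_fun setT phi' by rewrite /phi'; mfun.
have mchi' : measurable_fun setT chi' by rewrite /chi'; mfun.
have chi0 x : (0 <= chi x)%E by rewrite /chi; nonneg.
have phi0' x : (0 <= phi' x)%E by exact: phi0.
have chi0' x : (0 <= chi' x)%E by exact: chi0.
have Mb0 : 0 <= M / b by rewrite divr_ge0 ?ltW.
have sections (Q : 'M[R]_(d, n)) : Q *m Q^T = 1%:M ->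
    (\int[lam d]_z phi (z *m Q)%R <= M%:E)%E.
  move=> QQ; apply: le_trans maxM; apply: ereal_sup_ubound; exists Q => //.
  have mphiQ : measurable_fun setT (fun y : 'rV[R]_d => phi (y *m Q)) by mfun.
  exact: (iintE mphiQ (fun y => phi0 _)).
have transfer : (\int[lam n]_x (omega d n (l1norm x) * phi' x) <=
    (M / b)%:E * \int[lam n]_x (omega d n (l1norm x) * chi' x))%E.
  apply: section_transfer => // G.
  (* The rescaling is moved from the functions into the matrix. Since [section_bound] covers every
     matrix, only sections of the original [mu] and of the round ball occur. *)
  pose G' : 'M[R]_(d, n) := \matrix_(i, j) (G i j * a j).
  have DG z : D (z *m G) = z *m G'.
    apply/rowP => j; rewrite !mxE addr0 mulr_sumr.
    by apply: eq_bigr => i _; rewrite mxE; ring.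
  have e1 : (\int[lam d]_z phi' (z *m G)%R = \int[lam d]_z phi (z *m G')%R)%E.
    by apply: eq_integral => z _; rewrite /phi' DG.
  have e2 : (\int[lam d]_z chi' (z *m G)%R =
      \int[lam d]_z ((enorm (z *m G') <= 1)%R%:R)%:E)%E.
    by apply: eq_integral => z _; rewrite /chi' DG.
  rewrite e1 e2; exact: section_bound.
have lower : (omega d n n%:R * \int[lam n]_x phi' x <=
    \int[lam n]_x (omega d n (l1norm x) * phi' x))%E.
  have [om omE] : exists om, om = omega d n n%:R :> \bar R by eexists.
  have om0 : (0 <= om)%E by rewrite omE.
  rewrite -omE.
  apply: (@le_trans _ _ (\int[lam n]_x (om * phi' x))%E).
    by rewrite (ge0_integralZl (lam n) measurableT mphi' (fun x _ => phi0' x) om0).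
  have mle : measurable_fun setT (fun x => om * phi' x)%E by mfun.
  have mre : measurable_fun setT (fun x => omega d n (l1norm x) * phi' x)%E by mfun.
  apply: (ge0_le_integral (lam n) measurableT _ mle mre).
    by move=> x _; apply: mule_ge0.
  move=> x _; rewrite {om0 mle}omE /phi' /phi indicE.
  case: (boolP (D x \in L)) => [|_]; last by rewrite mul0r !mule0.
  rewrite inE => LDx; apply: lee_wpmul2r; first by rewrite mul1r lee_fin; exact: g0.
  apply: omega_le; apply: le_trans (Lo _ LDx); rewrite /l1norm.
  apply: ler_sum => i _; rewrite mxE addr0 normrM (gtr0_norm (a0 i)).
  by rewrite mulrAC divff ?mul1r// gt_eqF.
have [V [V0 V1 VI]] := integral_l1ball n.
pose E : set 'rV[R]_n := D @^-1` cball n 1.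
have mE : measurable E.
  by rewrite -[E]setTI; apply: mD => //; exact: measurable_cball.
have chiE x : chi' x = (\1_E x)%:E.
  rewrite /chi' /chi indicE.
  by case: (boolP (enorm (D x) <= 1)) => xr; [rewrite mem_set|rewrite memNset//; exact/negP].
have Em : lam n E = (B / A)%:E.
  rewrite -[E]setIT -integral_indic//.
  transitivity (\int[lam n]_x chi (D x))%E.
    by apply: eq_integral => x _; rewrite -chiE.
  by apply: (etrans (scaled _ mchi chi0)); rewrite BI -EFinM mulrC.
have BA0 : 0 < B / A by rewrite divr_gt0.
have upper := integral_omega_le d0 k0 mE Em BA0 VI V0.
have e3 : (\int[lam n]_x (omega d n (l1norm x) * chi' x) =
    \int[lam n]_x (omega d n (l1norm x) * (\1_E x)%:E))%E.
  by apply: eq_integral => x _; rewrite chiE.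
set C := (n%:R / d%:R * _) in upper.
(* [omega(n)] multiplies both the lower and the upper bound; being positive and finite, it
   cancels. *)
have om_pos : (0 < omega d n n%:R :> \bar R)%E.
  by move: d0 => /prednK <-; exact: omega_gt0.
have om_fin : (omega d n n%:R < +oo :> \bar R)%E by exact: omega_lty.
have step : (\int[lam n]_x phi' x <= (M / b * C)%:E)%E.
  rewrite e3 in transfer.
  have := le_trans lower (le_trans transfer (lee_wpmul2l _ upper)).
  rewrite lee_fin => /(_ Mb0).
  move: om_pos om_fin; case: (omega d n n%:R) => [w| |]//; rewrite lte_fin => w0 _.
  have -> : ((M / b)%:E * (w%:E * C%:E) = w%:E * (M / b * C)%:E)%E.
    by rewrite -!EFinM; congr EFin; ring.
  by rewrite lee_pmul2l.
have -> : mu_of g L = (A%:E * \int[lam n]_x phi' x)%E.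
  rewrite [in RHS](scaled _ mphi phi0) muleA -EFinM divff ?mul1e ?gt_eqF//.
  exact: (iintE mphi phi0).
apply: (le_trans (lee_wpmul2l _ step)); first by rewrite lee_fin ltW.
rewrite -EFinM lee_fin.
have -> : A * (M / b * C) = M / b * (n%:R / d%:R) * (B * (V / (B / A)) `^ (k%:R / n%:R)).
  by rewrite /C; field; rewrite !gt_eqF.
rewrite [X in _ <= X](_ : _ = M / b * (n%:R / d%:R) *
   (expR k%:R * B `^ (d%:R / n%:R) * v `^ (k%:R / n%:R))); last by ring.
rewrite -powR_volume_identity//.
rewrite ler_wpM2l//; first by rewrite mulr_ge0// divr_ge0 ?ltW.
rewrite ler_wpM2l ?(ltW B0)//.
(* It remains to compare the bases: [V A <= (2e)^n A <= e^n v], as [L] contains a box of volume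
   [2^n A]. *)
apply: ge0_ler_powR; rewrite ?nnegrE ?divr_ge0 ?mulr_ge0 ?exprn_ge0 ?expR_ge0 ?(ltW V0) ?(ltW A0) ?(ltW BA0) ?(ltW B0) ?(ltW v0) ?(ltW nd)//.
rewrite invf_div mulrA ler_wpM2r ?invr_ge0 ?(ltW B0)//.
apply: (@le_trans _ _ ((2 * expR 1) ^+ n * A)); first by rewrite ler_wpM2r// ltW.
rewrite (_ : (2 * expR 1) ^+ n * A = expR 1 ^+ n * (2 ^+ n * A)); last by rewrite exprMn; ring.
by rewrite ler_wpM2l// exprn_ge0// expR_ge0.
Qed.

End UnconditionalBodies.

Theorem theorem2 (R : realType) (n k : nat) (L : set 'rV[R]_n) (g : 'rV[R]_n -> R) :
  (2 <= n)%N -> (1 <= k)%N -> (k < n)%N ->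
  convex_body L -> unconditional L ->
  {within L, continuous g} ->
  (forall x, L x -> 0 <= g x) ->
  (forall x, L x -> g (- x) = g x) ->
  (mu_of g L <=
     (expR k%:R * (n%:R / (n - k)%:R) * c_const R n k
        * fine (vol L) `^ (k%:R / n%:R))%:E
     * max_section (n - k) g L)%E.
Proof.
move=> _ k0 kn Lb Lu cg g0 _.
have d0 : (0 < n - k)%N by rewrite subn_gt0.
rewrite /c_const.
(* Writing [n = d + k] removes the truncated subtraction. *)
move: L g Lb Lu cg g0; have -> : n = ((n - k) + k)%N by rewrite subnK// ltnW.
rewrite addnK; move: (n - k)%N d0 => d d0 L g Lb Lu cg g0 {n kn}.
have [b b0 [bE _]] := vol_eball_real R d.
have [B B0 [BE _]] := vol_eball_real R (d + k).
have mL := closed_measurable_rV (convex_body_closed Lb).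
have [a [a0 aL Lo]] := unconditional_lozanovskii Lb Lu.
have [v v0 vE] : exists2 v : R, 0 < v & vol L = v%:E.
  rewrite volE//.
  have lo : (0 < lebesgue_rV R (d + k) L)%E.
    apply: (@lt_le_trans _ _ (lebesgue_rV R (d + k) (box a))).
      rewrite lebesgue_box; last by move=> i; exact: ltW.
      by rewrite lte_fin prodr_gt0// => i _; rewrite mulr_gt0.
    by apply: le_measure; rewrite ?inE//; exact: measurable_box.
  (* Each term of [sum |x_i|/a_i <= n] is at most [n], so [L] lies in the box with half-sides
     [n a_i]. *)
  have up : (lebesgue_rV R (d + k) L < +oo)%E.
    apply: (@le_lt_trans _ _ (lebesgue_rV R (d + k) (box (fun i => (d + k)%:R * a i)))).
      apply: le_measure; rewrite ?inE//; first exact: measurable_box.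
      move=> x Lx i; rewrite -ler_pdivrMr//; apply: le_trans (Lo x Lx).
      rewrite (bigD1 i)//= lerDl sumr_ge0// => j _.
      by rewrite divr_ge0// ltW.
    by rewrite lebesgue_box ?ltry// => i; rewrite mulr_ge0// ltW.
  move: lo up; case: (lebesgue_rV R (d + k) L) => [v| |]//.
  by rewrite lte_fin => v0 _; exists v.
have main M := mu_of_le_sections d0 k0 Lb Lu cg g0 bE BE vE (M := M).
rewrite BE bE vE /=.
set K := expR k%:R * _ * _ * _.
have K0 : 0 < K.
  by rewrite !mulr_gt0 ?expR_gt0 ?invr_gt0 ?powR_gt0 ?ltr0n// addn_gt0 d0.
have max0 : (0 <= max_section d g L)%E.
  (* One coordinate section rules out the value [-oo] for the supremum. *)
  pose Q : 'M[R]_(d, d + k) := pid_mx d.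
  have QQ : Q *m Q^T = 1%:M by rewrite tr_pid_mx pid_mx_id ?leq_addr// pid_mx_1.
  apply: le_trans (_ : (mu_section g L Q <= _)%E); last by apply: ereal_sup_ubound; exists Q.
  have mphi := continuous_restrict_measurable (convex_body_closed Lb) cg.
  have phi0 x : (0 <= (\1_L x * g x)%:E)%E.
    rewrite lee_fin indicE; case: (boolP (x \in L)) => [|_]; last by rewrite mul0r.
    by rewrite inE mul1r; exact: g0.
  rewrite /mu_section iintE//; first by apply: integral_ge0.
  apply: (measurableT_comp mphi); exact: measurable_mulmx.
(* An infinite supremum makes the right-hand side infinite because [0 < K]. A finite one may vanish,
   while the estimate asks for a positive bound, so it is applied to [M + e/K] with [e] arbitrarily
   small. *)
move: max0 main; case: (max_section d g L) => [M| |]// M0 main; last by rewrite gt0_muley ?leey.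
apply/lee_addgt0Pr => e e0.
have eK : 0 < e / K by rewrite divr_gt0.
have := main (M + e / K); rewrite lee_fin lerDl (ltW eK) ltr_wpDl//.
move=> /(_ isT isT) H; apply: le_trans H _.
by rewrite -EFinM -EFinD lee_fin -/K mulrDr lerD2l mulrC divfK ?gt_eqF.
Qed.
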